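(* Let $M$ be a generic regular closed curve in $\mathbb{R}^2$. If $C$ is a smooth branch of $\mathrm{SC}(M)$ then the number of cusps of $C$ is even.
   Context: A closed regular curve $M$ is the image of a $C^\infty$ immersion $f:S^1\to\mathbb{R}^2$. A parallel pair of $M$ is a pair of points $a,b\in M$, $a\neq b$, such that the tangent lines to $M$ at $a$ and $b$ are parallel. The secant caustic is $\mathrm{SC}(M)=\mathrm{cl}\{a-b : a,b \text{ is a parallel pair of } M\}$. A point of $M$ is an inflexion point if the signed curvature changes sign there; an undulation point is a point where the curvature vanishes without changing sign. An inflexion point $f(s_0)$ is non-degenerate if $\det(f'(s_0),f'''(s_0))\neq 0$. $M$ is parameterized in the same direction at $f(s_1)$ and $f(s_2)$ if $f'(s_1)=\alpha f'(s_2)$ with $\alpha>0$. $M$ is generic if: (i) $f$ is regular; (ii) $f$ has only non-degenerate inflexion points and no undulation points; (iii) $f$ has only transversal self-crossings; (iv) if $f(s_1),f(s_2)$ is a parallel pair then at least one of them is not an inflexion point; (v) if $f(s_1),f(s_2)$ with $s_1\neq s_2$ is a parallel pair and, for local arc length parameterizations near $s_1$ and $s_2$ chosen in the same direction, the signed curvatures at $f(s_1)$ and $f(s_2)$ are equal, then the derivatives of the curvatures with respect to arc length at these points are different. The smooth branches of $\mathrm{SC}(M)$ are the smooth parameterized closed curves obtained by restricting $(s,t)\mapsto f(s)-f(t)$ to the connected components of $\Sigma=\mathrm{cl}\{(s,t)\in S^1\times S^1: s\neq t,\ \det(f'(s),f'(t))=0\}$, a smooth $1$-dimensional submanifold. A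 singular point of a parameterized curve is a cusp if, up to diffeomorphic changes of the parameter and of the plane, the curve is $t\mapsto(t^2,t^3)$ there. Cusps are counted along the parameterized branch. *)

(* Defs.v *)
From Stdlib Require Import Reals List.
From Coquelicot Require Import Coquelicot.
Open Scope R_scope.

Definition plane : Type := (R * R)%type.

Definition det2 (v w : plane) : R := fst v * snd w - snd v * fst w.
Definition vsub (v w : plane) : plane := (fst v - fst w, snd v - snd w).
Definition enorm (v : plane) : R := sqrt (fst v ^ 2 + snd v ^ 2).
Definition same_direction (v w : plane) : Prop :=
  exists alpha : R, 0 < alpha /\ v = (alpha * fst w, alpha * snd w).

(* The two predicates below become C^oo smoothness when required at every
   point of an open set, which is the only way they are used. *)
Definition smooth_at (h : R -> R) (t : R) : Prop :=
  forall n : nat, ex_derive_n h n t.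
Definition smooth2_at (P : plane -> plane) (z : plane) : Prop :=
  forall n : nat,
    ex_diff_n (fun x y => fst (P (x, y))) n (fst z) (snd z) /\
    ex_diff_n (fun x y => snd (P (x, y))) n (fst z) (snd z).

Definition smooth_curve (f : R -> plane) : Prop :=
  forall t : R,
    smooth_at (fun u => fst (f u)) t /\ smooth_at (fun u => snd (f u)) t.

Definition deriv (n : nat) (f : R -> plane) (t : R) : plane :=
  (Derive_n (fun u => fst (f u)) n t, Derive_n (fun u => snd (f u)) n t).

(* S^1 is the unit circle and S^1 x S^1 the corresponding subset of
   R^2 x R^2; maps on S^1 are given as 2 PI-periodic functions of the angle. *)
Definition circle_pt (s : R) : plane := (cos s, sin s).
Definition torus_pt (p : R * R) : plane * plane :=
  (circle_pt (fst p), circle_pt (snd p)).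

Definition closed_regular_curve (f : R -> plane) : Prop :=
  smooth_curve f /\
  (forall t : R, f (t + 2 * PI) = f t) /\
  (forall t : R, deriv 1 f t <> (0, 0)).

Definition curvature (f : R -> plane) (t : R) : R :=
  det2 (deriv 1 f t) (deriv 2 f t) / enorm (deriv 1 f t) ^ 3.

Definition changes_sign (g : R -> R) (s0 : R) : Prop :=
  exists delta : R, 0 < delta /\
    forall u v : R, s0 - delta < u < s0 -> s0 < v < s0 + delta -> g u * g v < 0.

Definition inflexion (f : R -> plane) (s : R) : Prop :=
  changes_sign (curvature f) s.
Definition undulation (f : R -> plane) (s : R) : Prop :=
  curvature f s = 0 /\ ~ changes_sign (curvature f) s.
Definition nondegenerate_inflexion (f : R -> plane) (s : R) : Prop :=
  inflexion f s /\ det2 (deriv 1 f s) (deriv 3 f s) <> 0.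

Definition parallel_pair (f : R -> plane) (s1 s2 : R) : Prop :=
  f s1 <> f s2 /\ det2 (deriv 1 f s1) (deriv 1 f s2) = 0.

(* p is a parameterization by arc length of f near s0, with p(0) = f(s0);
   it may traverse the curve in either direction. *)
Definition local_arc_length_param (f : R -> plane) (s0 : R) (p : R -> plane)
  : Prop :=
  exists h : R -> R, h 0 = s0 /\
    locally 0 (fun u =>
      smooth_at h u /\ p u = f (h u) /\ enorm (deriv 1 p u) = 1).

Record generic (f : R -> plane) : Prop := Generic {
  generic_regular : closed_regular_curve f;
  generic_inflexion : forall s : R, inflexion f s -> nondegenerate_inflexion f s;
  generic_undulation : forall s : R, ~ undulation f s;
  generic_crossing : forall s1 s2 : R,
    circle_pt s1 <> circle_pt s2 -> f s1 = f s2 ->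
    det2 (deriv 1 f s1) (deriv 1 f s2) <> 0;
  generic_parallel_inflexion : forall s1 s2 : R,
    parallel_pair f s1 s2 -> ~ inflexion f s1 \/ ~ inflexion f s2;
  generic_parallel_curvature : forall s1 s2 : R,
    circle_pt s1 <> circle_pt s2 -> parallel_pair f s1 s2 ->
    forall p1 p2 : R -> plane,
      local_arc_length_param f s1 p1 -> local_arc_length_param f s2 p2 ->
      same_direction (deriv 1 p1 0) (deriv 1 p2 0) ->
      curvature p1 0 = curvature p2 0 ->
      Derive (curvature p1) 0 <> Derive (curvature p2) 0 }.

Definition closure {T : UniformSpace} (A : T -> Prop) (x : T) : Prop :=
  forall P : T -> Prop, locally x P -> exists y : T, P y /\ A y.

Definition connected {T : UniformSpace} (B : T -> Prop) : Prop :=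
  forall U V : T -> Prop, open U -> open V ->
    (forall x, B x -> U x \/ V x) ->
    (exists x, B x /\ U x) -> (exists x, B x /\ V x) ->
    exists x, B x /\ U x /\ V x.

Definition is_connected_component {T : UniformSpace} (A K : T -> Prop) : Prop :=
  exists x : T, A x /\
    forall y : T, K y <->
      exists B : T -> Prop,
        connected B /\ (forall z, B z -> A z) /\ B x /\ B y.

Definition Sigma (f : R -> plane) : plane * plane -> Prop :=
  closure (fun q : plane * plane =>
    exists s t : R, q = torus_pt (s, t) /\ circle_pt s <> circle_pt t /\
      det2 (deriv 1 f s) (deriv 1 f t) = 0).

(* gam, a lift to R^2 of a map S^1 -> S^1 x S^1, is a regular smooth injective
   closed parameterization of K. *)
Definition closed_param (gam : R -> R * R) (K : plane * plane -> Prop) : Prop :=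
  smooth_curve gam /\
  (forall t : R, torus_pt (gam (t + 2 * PI)) = torus_pt (gam t)) /\
  (forall t : R, deriv 1 gam t <> (0, 0)) /\
  (forall t1 t2 : R,
     torus_pt (gam t1) = torus_pt (gam t2) -> circle_pt t1 = circle_pt t2) /\
  (forall q : plane * plane, K q <-> exists t : R, q = torus_pt (gam t)).

Definition smooth_branch (f C : R -> plane) : Prop :=
  exists (K : plane * plane -> Prop) (gam : R -> R * R),
    is_connected_component (Sigma f) K /\ closed_param gam K /\
    forall t : R, C t = vsub (f (fst (gam t))) (f (snd (gam t))).

(* Germs of C^oo diffeomorphisms (R, a) -> (R, b) and (R^2, a) -> (R^2, b). *)
Definition local_diffeo (phi : R -> R) (a b : R) : Prop :=
  phi a = b /\
  exists psi : R -> R,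
    locally a (fun t => smooth_at phi t /\ psi (phi t) = t) /\
    locally b (fun u => smooth_at psi u /\ phi (psi u) = u).
Definition local_diffeo2 (Phi : plane -> plane) (a b : plane) : Prop :=
  Phi a = b /\
  exists Psi : plane -> plane,
    locally a (fun z => smooth2_at Phi z /\ Psi (Phi z) = z) /\
    locally b (fun w => smooth2_at Psi w /\ Phi (Psi w) = w).

Definition cusp (C : R -> plane) (t0 : R) : Prop :=
  deriv 1 C t0 = (0, 0) /\
  exists (phi : R -> R) (Phi : plane -> plane),
    local_diffeo phi 0 t0 /\ local_diffeo2 Phi (C t0) (0, 0) /\
    locally 0 (fun t => Phi (C (phi t)) = (t ^ 2, t ^ 3)).

(* Main.v *)
Require Import Defs.
From Stdlib Require Import Reals List.
From Stdlib Require Import ZArith Ranalysis5 Bool Lra Lia Classical ClassicalEpsilon.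
From Coquelicot Require Import Coquelicot.
Open Scope R_scope.

(** Along a branch C(u) = f(a(u)) - f(b(u)) the tangents of the curve at the two points
    are parallel, so f'(a) = lambda f'(b) for a nowhere vanishing function lambda, and
    C' = h f'(b) with h = a' lambda - b' ([caustic_speed]). The vector f'(b) never
    vanishes, so the singular points of C are the zeros of h, and h is periodic although
    the angles a and b need not be. A periodic function with only simple zeros changes
    sign an even number of times over a period ([even_number_of_simple_zeros]). It remains
    to see that the zeros of h are simple and that they are the cusps of C.

    Differentiating det (f'(a), f'(b)) = 0 shows that the two tangents turn at the same
    rate ([equal_turning]). Therefore h vanishes exactly where the curvatures at the two
    points, taken along a common direction, are equal, and there h' vanishes only if the
    derivatives of the curvatures with respect to arc length are equal as well, which
    genericity excludes ([caustic_speed_simple_zero]). A branch can also pass through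
    pairs (s, s). By Rolle's theorem f(s) is then an inflexion, and the two points of
    neighbouring pairs lie on opposite sides of it; so a and b move in opposite
    directions, while lambda = 1, and h does not vanish ([caustic_speed_diagonal]).

    At a simple zero of h the vectors C'' and C''' are independent. That such a point is
    a cusp, in the sense of smooth changes of the parameter and of the plane, is a
    normal form theorem ([cusp_of_independent_derivatives]). In suitable coordinates the
    curve is (s^2, s^3 W(s)) with W(0) = 1. By Whitney's theorem W splits as
    E(s^2) + s O(s^2) with E and O smooth ([Whitney_even_odd]), and then the map
    (x, y) |-> (x, (y - x^2 O(x)) / E(x)) sends the curve to (s^2, s^3). Since E and O
    are determined only for x >= 0, extending them smoothly to x < 0 uses
    Borel's lemma ([Borel]). *)

(** * Calculus of smooth functions on an open subset of the line *)

Definition differentiable_n (n : nat) (D : R -> Prop) (g : R -> R) : Prop :=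
  forall t, D t -> forall k, (k <= n)%nat -> ex_derive_n g k t.

Definition smooth_on (D : R -> Prop) (g : R -> R) : Prop :=
  forall t, D t -> smooth_at g t.

Lemma smooth_on_differentiable_n D g : smooth_on D g <-> forall n, differentiable_n n D g.
Proof.
  split.
  - intros H n t Ht k _. exact (H t Ht k).
  - intros H t Ht n. exact (H n t Ht n (Nat.le_refl n)).
Qed.

Lemma differentiable_n_le m n D g : (m <= n)%nat -> differentiable_n n D g -> differentiable_n m D g.
Proof. intros Hmn H t Ht k Hk. apply H; [exact Ht | lia]. Qed.

Lemma differentiable_n_0 D g : differentiable_n 0 D g.
Proof. intros t _ k Hk. replace k with 0%nat by lia. exact I. Qed.

Lemma differentiable_n_ex_derive n D g t : differentiable_n (S n) D g -> D t -> ex_derive g t.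
Proof. intros H Ht. exact (H t Ht 1%nat ltac:(lia)). Qed.

Lemma ex_derive_n_Derive g k t :
  ex_derive_n (Derive g) k t <-> (k = 0%nat \/ ex_derive_n g (S k) t).
Proof.
  destruct k as [|k]; simpl.
  - tauto.
  - assert (E : forall u, Derive_n (Derive g) k u = Derive (Derive_n g k) u).
    { intros u. change (Derive g) with (Derive_n g 1).
      rewrite Derive_n_comp. now rewrite Nat.add_1_r. }
    split.
    + intros H. right. eapply ex_derive_ext; [exact E | exact H].
    + intros [H|H]; [discriminate|].
      eapply ex_derive_ext; [intros u; symmetry; apply E | exact H].
Qed.

Lemma differentiable_n_Derive n D g : differentiable_n (S n) D g -> differentiable_n n D (Derive g).
Proof.
  intros H t Ht k Hk. apply ex_derive_n_Derive. right. apply H; [exact Ht | lia].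
Qed.

Lemma differentiable_n_ext n D g h : open D -> (forall t, D t -> g t = h t) -> differentiable_n n D g -> differentiable_n n D h.
Proof.
  intros HD E H t Ht k Hk. apply ex_derive_n_ext_loc with g.
  - apply (filter_imp D); [exact E | exact (HD t Ht)].
  - now apply H.
Qed.

(** The step by which the closure properties below are proved by induction on
    the order of differentiability. *)
Lemma differentiable_n_intro n D g g' :
  open D -> (forall t, D t -> is_derive g t (g' t)) -> differentiable_n n D g' -> differentiable_n (S n) D g.
Proof.
  intros HD Hg H t Ht [|k] Hk; [exact I|].
  assert (Hd : differentiable_n n D (Derive g)).
  { apply differentiable_n_ext with g'; [exact HD | | exact H].
    intros u Hu. symmetry. apply is_derive_unique. now apply Hg. }
  destruct k as [|k].
  - exists (g' t). now apply Hg.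
  - destruct (proj1 (ex_derive_n_Derive g (S k) t)) as [F|F].
    + apply Hd; [exact Ht | lia].
    + discriminate.
    + exact F.
Qed.

Lemma differentiable_n_const n D c : differentiable_n n D (fun _ => c).
Proof. intros t _ k _. apply ex_derive_n_const. Qed.

Lemma differentiable_n_id n D : open D -> differentiable_n n D (fun t => t).
Proof.
  intros HD. destruct n; [apply differentiable_n_0|].
  apply differentiable_n_intro with (fun _ => 1); [exact HD | | apply differentiable_n_const].
  intros t _. exact (is_derive_id (K := R_AbsRing) t).
Qed.

Lemma differentiable_n_plus n D g h : open D -> differentiable_n n D g -> differentiable_n n D h -> differentiable_n n D (fun t => g t + h t).
Proof.
  intros HD. revert g h. induction n as [|n IH]; intros g h Hg Hh; [apply differentiable_n_0|].
  apply differentiable_n_intro with (fun t => Derive g t + Derive h t); [exact HD | |].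
  - intros t Ht. apply (is_derive_plus (V := R_NormedModule) g h);
      apply Derive_correct; eapply differentiable_n_ex_derive; eauto.
  - apply IH; now apply differentiable_n_Derive.
Qed.

Lemma differentiable_n_mult n D g h : open D -> differentiable_n n D g -> differentiable_n n D h -> differentiable_n n D (fun t => g t * h t).
Proof.
  intros HD. revert g h. induction n as [|n IH]; intros g h Hg Hh; [apply differentiable_n_0|].
  apply differentiable_n_intro with (fun t => Derive g t * h t + g t * Derive h t); [exact HD | |].
  - intros t Ht. apply (is_derive_mult g h t); [| | exact Rmult_comm];
      apply Derive_correct; eapply differentiable_n_ex_derive; eauto.
  - assert (differentiable_n n D g) by (apply differentiable_n_le with (S n); auto).
    assert (differentiable_n n D h) by (apply differentiable_n_le with (S n); auto).
    apply differentiable_n_plus; [exact HD | |]; apply IH; auto using differentiable_n_Derive.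
Qed.

Lemma differentiable_n_comp n D D' g k : open D -> open D' -> (forall t, D t -> D' (k t)) ->
  differentiable_n n D' g -> differentiable_n n D k -> differentiable_n n D (fun t => g (k t)).
Proof.
  intros HD HD' Hk. revert g. induction n as [|n IH]; intros g Hg Hkk; [apply differentiable_n_0|].
  apply differentiable_n_intro with (fun t => Derive k t * Derive g (k t)); [exact HD | |].
  - intros t Ht. apply (is_derive_comp (V := R_NormedModule) g k t).
    + apply Derive_correct. eapply differentiable_n_ex_derive; eauto.
    + apply Derive_correct. eapply differentiable_n_ex_derive; eauto.
  - apply differentiable_n_mult; [exact HD | now apply differentiable_n_Derive|].
    apply IH; [now apply differentiable_n_Derive | apply differentiable_n_le with (S n); auto].
Qed.

Lemma differentiable_n_inv n D g : open D -> (forall t, D t -> g t <> 0) ->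
  differentiable_n n D g -> differentiable_n n D (fun t => / g t).
Proof.
  intros HD Hnz. induction n as [|n IH]; intros Hg; [apply differentiable_n_0|].
  apply differentiable_n_intro with (fun t => (-1 * Derive g t) * (/ g t * / g t)); [exact HD | |].
  - intros t Ht.
    replace (-1 * Derive g t * (/ g t * / g t)) with (- Derive g t / g t ^ 2)
      by (field; now apply Hnz).
    apply is_derive_inv; [|now apply Hnz].
    apply Derive_correct; eapply differentiable_n_ex_derive; eauto.
  - assert (differentiable_n n D (fun t => / g t)) by (apply IH, differentiable_n_le with (S n); auto).
    apply differentiable_n_mult; [exact HD | |apply differentiable_n_mult; auto].
    apply differentiable_n_mult; [exact HD | apply differentiable_n_const | now apply differentiable_n_Derive].
Qed.

Lemma differentiable_n_sqrt n D g : open D -> (forall t, D t -> 0 < g t) ->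
  differentiable_n n D g -> differentiable_n n D (fun t => sqrt (g t)).
Proof.
  intros HD Hpos. induction n as [|n IH]; intros Hg; [apply differentiable_n_0|].
  apply differentiable_n_intro with (fun t => Derive g t * / (2 * sqrt (g t))); [exact HD | |].
  - intros t Ht. apply is_derive_sqrt; [|now apply Hpos].
    apply Derive_correct; eapply differentiable_n_ex_derive; eauto.
  - apply differentiable_n_mult; [exact HD | now apply differentiable_n_Derive|].
    apply differentiable_n_inv; [exact HD | |].
    + intros t Ht. assert (0 < sqrt (g t)) by (apply sqrt_lt_R0; auto). lra.
    + apply differentiable_n_mult; [exact HD | apply differentiable_n_const | apply IH, differentiable_n_le with (S n); auto].
Qed.

Lemma smooth_on_sub (D D' : R -> Prop) g :
  (forall t, D' t -> D t) -> smooth_on D g -> smooth_on D' g.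
Proof. intros H Hg t Ht. apply Hg; auto. Qed.

Lemma smooth_on_ext D g h :
  open D -> (forall t, D t -> g t = h t) -> smooth_on D g -> smooth_on D h.
Proof.
  rewrite !smooth_on_differentiable_n. intros HD E H n. now apply differentiable_n_ext with g.
Qed.

Lemma smooth_on_ex_derive D g t : smooth_on D g -> D t -> ex_derive g t.
Proof. intros H Ht. exact (H t Ht 1%nat). Qed.

Lemma smooth_on_continuous D g t : smooth_on D g -> D t -> continuous g t.
Proof.
  intros H Ht. apply (ex_derive_continuous (V := R_NormedModule) g t).
  now apply smooth_on_ex_derive with D.
Qed.

Lemma smooth_on_Derive D g : smooth_on D g -> smooth_on D (Derive g).
Proof. rewrite !smooth_on_differentiable_n. intros H n. now apply differentiable_n_Derive. Qed.

Lemma smooth_on_Derive_n D g n : smooth_on D g -> smooth_on D (Derive_n g n).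
Proof.
  intros Hg. induction n as [|n IH]; [exact Hg|]. now apply smooth_on_Derive.
Qed.

Lemma smooth_on_intro D g g' : open D -> (forall t, D t -> is_derive g t (g' t)) ->
  smooth_on D g' -> smooth_on D g.
Proof.
  rewrite !smooth_on_differentiable_n. intros HD Hg H n. apply differentiable_n_le with (S n); [lia|].
  now apply differentiable_n_intro with g'.
Qed.

Lemma smooth_on_const D c : smooth_on D (fun _ => c).
Proof. apply smooth_on_differentiable_n. intros n. apply differentiable_n_const. Qed.

Lemma smooth_on_id D : open D -> smooth_on D (fun t => t).
Proof. intros HD. apply smooth_on_differentiable_n. intros n. now apply differentiable_n_id. Qed.

Lemma smooth_on_plus D g h : open D ->
  smooth_on D g -> smooth_on D h -> smooth_on D (fun t => g t + h t).
Proof. rewrite !smooth_on_differentiable_n. intros HD Hg Hh n. now apply differentiable_n_plus. Qed.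

Lemma smooth_on_mult D g h : open D ->
  smooth_on D g -> smooth_on D h -> smooth_on D (fun t => g t * h t).
Proof. rewrite !smooth_on_differentiable_n. intros HD Hg Hh n. now apply differentiable_n_mult. Qed.

Lemma smooth_on_opp D g : open D -> smooth_on D g -> smooth_on D (fun t => - g t).
Proof.
  intros HD Hg. apply smooth_on_ext with (fun t => -1 * g t); [exact HD | intros; ring|].
  apply smooth_on_mult; auto using smooth_on_const.
Qed.

Lemma smooth_on_minus D g h : open D ->
  smooth_on D g -> smooth_on D h -> smooth_on D (fun t => g t - h t).
Proof.
  intros HD Hg Hh. unfold Rminus. apply smooth_on_plus; auto using smooth_on_opp.
Qed.

Lemma smooth_on_pow D g n : open D -> smooth_on D g -> smooth_on D (fun t => g t ^ n).
Proof.
  intros HD Hg. induction n as [|n IH]; simpl; auto using smooth_on_const, smooth_on_mult.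
Qed.

Lemma smooth_on_comp D D' g k : open D -> open D' -> (forall t, D t -> D' (k t)) ->
  smooth_on D' g -> smooth_on D k -> smooth_on D (fun t => g (k t)).
Proof.
  rewrite !smooth_on_differentiable_n. intros HD HD' H Hg Hh n. now apply differentiable_n_comp with D'.
Qed.

Lemma smooth_on_inv D g : open D -> (forall t, D t -> g t <> 0) ->
  smooth_on D g -> smooth_on D (fun t => / g t).
Proof. rewrite !smooth_on_differentiable_n. intros HD H Hg n. now apply differentiable_n_inv. Qed.

Lemma smooth_on_div D g h : open D -> (forall t, D t -> h t <> 0) ->
  smooth_on D g -> smooth_on D h -> smooth_on D (fun t => g t / h t).
Proof. intros. unfold Rdiv. apply smooth_on_mult; auto using smooth_on_inv. Qed.

Lemma smooth_on_sqrt D g : open D -> (forall t, D t -> 0 < g t) ->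
  smooth_on D g -> smooth_on D (fun t => sqrt (g t)).
Proof. rewrite !smooth_on_differentiable_n. intros HD H Hg n. now apply differentiable_n_sqrt. Qed.

Definition everywhere : R -> Prop := fun _ => True.
Definition near0 (d : R) : R -> Prop := fun t => - d < t < d.

Lemma open_everywhere : open everywhere.
Proof. exact open_true. Qed.

Lemma open_between a b : open (fun t : R => a < t < b).
Proof. apply open_and; [apply open_gt | apply open_lt]. Qed.

Lemma open_near0 d : open (near0 d).
Proof. apply open_between. Qed.

#[export] Hint Resolve open_everywhere open_near0 open_between smooth_on_const smooth_on_id smooth_on_plus
  smooth_on_mult smooth_on_opp smooth_on_minus smooth_on_pow smooth_on_Derive
  smooth_on_Derive_n : smooth.

Lemma locally_R (x : R) (P : R -> Prop) :
  locally x P <-> exists d, 0 < d /\ forall y, x - d < y < x + d -> P y.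
Proof.
  split.
  - intros [d H]. exists d. split; [apply cond_pos|]. intros y Hy. apply H.
    apply Rabs_def1; unfold minus, plus, opp; simpl; lra.
  - intros (d & Hd & H). exists (mkposreal d Hd). intros y Hy. apply H.
    apply Rabs_def2 in Hy. unfold minus, plus, opp in Hy; simpl in Hy. lra.
Qed.

(** ** Inverse functions *)

Section IncreasingInverse.

Variables (D : R -> Prop) (g : R -> R) (t0 r m : R).
Hypotheses (HD : open D) (Hg : smooth_on D g) (r0 : 0 < r) (m0 : 0 < m).
Hypothesis (HDr : forall t, t0 - r <= t <= t0 + r -> D t /\ m <= Derive g t).

Let psi (y : R) : R := epsilon (inhabits 0) (fun x => t0 - r <= x <= t0 + r /\ g x = y).

Lemma increments_bounded_below a b :
  t0 - r <= a -> a <= b -> b <= t0 + r -> m * (b - a) <= g b - g a.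
Proof.
  intros Ha Hab Hb.
  destruct (MVT_gen g a b (Derive g)) as (c & Hc & E).
  - intros x Hx. rewrite Rmin_left, Rmax_right in Hx by lra.
    apply Derive_correct. apply smooth_on_ex_derive with D; [exact Hg|]. apply HDr; lra.
  - intros x Hx. rewrite Rmin_left, Rmax_right in Hx by lra.
    apply continuity_pt_filterlim. apply smooth_on_continuous with D; [exact Hg|]. apply HDr; lra.
  - rewrite Rmin_left, Rmax_right in Hc by lra. rewrite E.
    apply Rmult_le_compat_r; [lra|]. apply HDr; lra.
Qed.

Lemma local_inverse_value y : g t0 - m * r < y < g t0 + m * r ->
  t0 - r <= psi y <= t0 + r /\ g (psi y) = y.
Proof.
  intros Hy. unfold psi. apply epsilon_spec.
  assert (H1 := increments_bounded_below (t0 - r) t0 ltac:(lra) ltac:(lra) ltac:(lra)).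
  assert (H2 := increments_bounded_below t0 (t0 + r) ltac:(lra) ltac:(lra) ltac:(lra)).
  destruct (IVT_interv (fun x => g x - y) (t0 - r) (t0 + r)) as (x & Hx & E).
  - intros a Ha. apply continuity_pt_filterlim.
    apply (smooth_on_continuous D (fun x => g x - y)); [|apply HDr; lra].
    auto with smooth.
  - lra.
  - cbv beta. lra.
  - cbv beta. lra.
  - exists x. split; [lra|]. lra.
Qed.

Lemma local_inverse_unique t : t0 - r <= t <= t0 + r ->
  g t0 - m * r < g t < g t0 + m * r -> psi (g t) = t.
Proof.
  intros Ht Hy. destruct (local_inverse_value _ Hy) as [H1 H2].
  destruct (Rtotal_order (psi (g t)) t) as [H|[H|H]]; [|exact H|].
  - assert (K := increments_bounded_below (psi (g t)) t ltac:(lra) ltac:(lra) ltac:(lra)). nra.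
  - assert (K := increments_bounded_below t (psi (g t)) ltac:(lra) ltac:(lra) ltac:(lra)). nra.
Qed.

(** The derivative of g is at least m > 0, so the inverse is (1/m)-Lipschitz. This turns
    the first-order expansion of g at the preimage into one of the inverse. *)
Lemma local_inverse_derive y : g t0 - m * r < y < g t0 + m * r ->
  is_derive psi y (/ Derive g (psi y)).
Proof.
  intros Hy. apply is_derive_Reals. intros eps Heps.
  destruct (local_inverse_value y Hy) as [Hx Ex].
  destruct (HDr _ Hx) as [HDx Hl].
  set (x := psi y) in *. set (l := Derive g x) in *.
  assert (Hd : derivable_pt_lim g x l).
  { apply is_derive_Reals, Derive_correct. now apply smooth_on_ex_derive with D. }
  (* Below, k / h and 1 / l are at most 1 / m. *)
  destruct (Hd (eps * m * m)) as [d1 Hd1]; [apply Rmult_lt_0_compat; nra|].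
  set (e0 := Rmin (y - (g t0 - m * r)) (g t0 + m * r - y)).
  assert (He0 : 0 < Rmin e0 (d1 * m)).
  { apply Rmin_glb_lt; [apply Rmin_glb_lt; lra|]. apply Rmult_lt_0_compat; [apply cond_pos|lra]. }
  exists (mkposreal _ He0). intros h Hh Hhb. simpl in Hhb.
  assert (Hh1 : Rabs h < e0) by (eapply Rlt_le_trans; [exact Hhb | apply Rmin_l]).
  assert (Hh2 : Rabs h < d1 * m) by (eapply Rlt_le_trans; [exact Hhb | apply Rmin_r]).
  apply Rabs_def2 in Hh1.
  assert (e0 <= y - (g t0 - m * r)) by apply Rmin_l.
  assert (e0 <= g t0 + m * r - y) by apply Rmin_r.
  destruct (local_inverse_value (y + h)) as [Hx' Ex']; [lra|].
  set (k := psi (y + h) - x).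
  assert (Exk : psi (y + h) = x + k) by (unfold k; ring).
  rewrite Exk in *.
  assert (Hk : m * Rabs k <= Rabs h).
  { destruct (Rle_dec 0 k).
    - assert (K := increments_bounded_below x (x + k) ltac:(lra) ltac:(lra) ltac:(lra)).
      rewrite (Rabs_pos_eq k) by lra. apply Rle_trans with h; [|apply Rle_abs]. nra.
    - assert (K := increments_bounded_below (x + k) x ltac:(lra) ltac:(lra) ltac:(lra)).
      rewrite (Rabs_left k) by lra. rewrite <- Rabs_Ropp.
      apply Rle_trans with (- h); [|apply Rle_abs]. nra. }
  assert (Hk0 : k <> 0).
  { intros ->. rewrite Rplus_0_r in Ex'. lra. }
  assert (Hkd : Rabs k < d1).
  { apply Rmult_lt_reg_r with m; lra. }
  specialize (Hd1 k Hk0 Hkd). rewrite Ex', Ex in Hd1.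
  replace (y + h - y) with h in Hd1 by ring.
  replace (x + k - x) with k by ring.
  replace (k / h - / l) with ((k / h) * / l * (- (h / k - l))) by (field; repeat split; lra).
  rewrite !Rabs_mult, Rabs_Ropp.
  assert (A1 : Rabs (k / h) <= / m).
  { unfold Rdiv. rewrite Rabs_mult, Rabs_inv.
    assert (0 < Rabs h) by now apply Rabs_pos_lt.
    apply Rmult_le_reg_r with (Rabs h); [lra|]. rewrite Rmult_assoc, Rinv_l, Rmult_1_r by lra.
    apply Rmult_le_reg_l with m; [lra|]. rewrite <- Rmult_assoc, Rinv_r by lra. lra. }
  assert (A2 : Rabs (/ l) <= / m).
  { rewrite Rabs_inv, Rabs_pos_eq by lra. apply Rinv_le_contravar; lra. }
  apply Rle_lt_trans with (/ m * / m * Rabs (h / k - l)).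
  - apply Rmult_le_compat_r; [apply Rabs_pos|].
    apply Rmult_le_compat; auto using Rabs_pos.
  - apply Rlt_le_trans with (/ m * / m * (eps * m * m)).
    + apply Rmult_lt_compat_l; [|exact Hd1].
      apply Rmult_lt_0_compat; now apply Rinv_0_lt_compat.
    + right. field. lra.
Qed.

Lemma local_inverse_smooth : smooth_on (fun y => g t0 - m * r < y < g t0 + m * r) psi.
Proof.
  apply smooth_on_differentiable_n. intros n. induction n as [|n IH]; [apply differentiable_n_0|].
  apply differentiable_n_intro with (fun y => / Derive g (psi y)).
  - apply open_between.
  - exact local_inverse_derive.
  - apply differentiable_n_inv; [apply open_between | |].
    + intros y Hy. assert (K := proj2 (HDr _ (proj1 (local_inverse_value y Hy)))). lra.
    + apply differentiable_n_comp with D; [apply open_between | exact HD | | | exact IH].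
      * intros y Hy. exact (proj1 (HDr _ (proj1 (local_inverse_value y Hy)))).
      * now apply smooth_on_differentiable_n, smooth_on_Derive.
Qed.

End IncreasingInverse.

Definition has_smooth_inverse (D : R -> Prop) (g : R -> R) (t0 : R) : Prop :=
  exists (psi : R -> R) (d e : R), 0 < d /\ 0 < e /\
    smooth_on (fun y => g t0 - d < y < g t0 + d) psi /\
    (forall y, g t0 - d < y < g t0 + d -> D (psi y) /\ g (psi y) = y) /\
    (forall t, t0 - e < t < t0 + e -> psi (g t) = t).

Lemma smooth_inverse_increasing D g t0 : open D -> D t0 -> smooth_on D g ->
  0 < Derive g t0 -> has_smooth_inverse D g t0.
Proof.
  intros HD Ht0 Hg Hpos.
  assert (HL : locally t0 (fun t => D t /\ Derive g t0 / 2 < Derive g t)).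
  { apply filter_and; [now apply HD|].
    apply (smooth_on_continuous D (Derive g) t0); auto with smooth.
    apply (open_gt (Derive g t0 / 2)). lra. }
  apply locally_R in HL. destruct HL as (r' & Hr' & HL).
  set (r := r' / 2). set (m := Derive g t0 / 2).
  assert (r0 : 0 < r) by (unfold r; lra). assert (m0 : 0 < m) by (unfold m; lra).
  assert (HDr : forall t, t0 - r <= t <= t0 + r -> D t /\ m <= Derive g t).
  { intros t Ht. destruct (HL t) as [K1 K2]; [unfold r in Ht; lra|].
    split; [exact K1 | unfold m; lra]. }
  assert (Hmr : 0 < m * r) by now apply Rmult_lt_0_compat.
  assert (HL2 : locally t0 (fun t => g t0 - m * r < g t < g t0 + m * r)).
  { apply (smooth_on_continuous D g t0 Hg Ht0 (fun z => g t0 - m * r < z < g t0 + m * r)).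
    apply (open_between (g t0 - m * r) (g t0 + m * r)). lra. }
  apply locally_R in HL2. destruct HL2 as (e & He & HL2).
  exists (fun y => epsilon (inhabits 0) (fun x => t0 - r <= x <= t0 + r /\ g x = y)).
  exists (m * r), (Rmin e r). repeat split.
  - exact Hmr.
  - now apply Rmin_glb_lt.
  - now apply local_inverse_smooth with D.
  - apply HDr. now apply (local_inverse_value D g t0 r m).
  - now apply (local_inverse_value D g t0 r m).
  - intros t Ht. assert (Rmin e r <= e) by apply Rmin_l. assert (Rmin e r <= r) by apply Rmin_r.
    apply (local_inverse_unique D g t0 r m); auto; [lra|]. apply HL2. lra.
Qed.

Lemma inverse_function D g t0 : open D -> D t0 -> smooth_on D g ->
  Derive g t0 <> 0 -> has_smooth_inverse D g t0.
Proof.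
  intros HD Ht0 Hg Hnz. destruct (Rdichotomy _ _ Hnz) as [Hn|Hp];
    [|now apply smooth_inverse_increasing].
  destruct (smooth_inverse_increasing D (fun t => - g t) t0)
    as (psi & d & e & Hd & He & Hs & Hv & Hu); auto with smooth.
  { rewrite Derive_opp. lra. }
  exists (fun y => psi (- y)), d, e. repeat split; auto.
  - apply smooth_on_comp with (D' := fun y => - g t0 - d < y < - g t0 + d);
      auto with smooth.
    intros y Hy. lra.
  - apply Hv. lra.
  - destruct (Hv (- y)) as [_ K]; lra.
Qed.

(** * Division by the variable *)

Lemma near0_scale d s t : 0 <= s <= 1 -> near0 d t -> near0 d (s * t).
Proof. unfold near0. intros Hs Ht. nra. Qed.

(** The averages of g over the segment from 0 to t, weighted by powers of s:
    a family that differentiation maps to itself, with g replaced by g'. *)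
Definition ray_mean (k : nat) (g : R -> R) (t : R) : R :=
  RInt (fun s => s ^ k * g (s * t)) 0 1.

Lemma is_derive_dilation g s t : ex_derive g (s * t) ->
  is_derive (fun z => g (s * z)) t (s * Derive g (s * t)).
Proof.
  intros H. apply (is_derive_comp (V := R_NormedModule) g (fun z => s * z) t).
  - now apply Derive_correct.
  - assert (K := is_derive_scal (fun z : R => z) t s 1 (is_derive_id (K := R_AbsRing) t)).
    now rewrite Rmult_1_r in K.
Qed.

Lemma locally_2d_preimage (D : R -> Prop) (g : R -> R -> R) x y :
  open D -> continuity_2d_pt g x y -> D (g x y) -> locally_2d (fun u v => D (g u v)) x y.
Proof.
  intros HD Hg Hxy. destruct (proj1 (locally_R _ _) (HD _ Hxy)) as (e & He & H).
  destruct (Hg (mkposreal e He)) as [r Hr]. exists r. intros u v Hu Hv.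
  specialize (Hr u v Hu Hv). apply Rabs_def2 in Hr. simpl in Hr. apply H. lra.
Qed.

Lemma continuity_2d_pt_product x y : continuity_2d_pt (fun u v => v * u) x y.
Proof. apply continuity_2d_pt_mult; [apply continuity_2d_pt_id2 | apply continuity_2d_pt_id1]. Qed.

Lemma continuity_2d_pt_mean_integrand d k g t s :
  smooth_on (near0 d) g -> near0 d (s * t) ->
  continuity_2d_pt (fun u v => v ^ k * g (v * u)) t s.
Proof.
  intros Hg Hst. apply continuity_2d_pt_mult.
  - apply (continuity_1d_2d_pt_comp (fun v => v ^ k) (fun _ v => v)).
    + apply continuity_pt_filterlim.
      apply (smooth_on_continuous everywhere (fun v => v ^ k)); [auto with smooth | exact I].
    + apply continuity_2d_pt_id2.
  - apply (continuity_1d_2d_pt_comp g (fun u v => v * u)).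
    + apply continuity_pt_filterlim. now apply (smooth_on_continuous (near0 d)).
    + apply continuity_2d_pt_product.
Qed.

Lemma is_derive_ray_mean d k g t : smooth_on (near0 d) g -> near0 d t ->
  is_derive (ray_mean k g) t (ray_mean (S k) (Derive g) t).
Proof.
  intros Hg Ht.
  assert (Hex : forall u s, near0 d (s * u) ->
    is_derive (fun z => s ^ k * g (s * z)) u (s ^ S k * Derive g (s * u))).
  { intros u s H. replace (s ^ S k * Derive g (s * u)) with (s ^ k * (s * Derive g (s * u)))
      by (simpl; ring).
    apply (is_derive_scal (fun z => g (s * z))), is_derive_dilation.
    now apply smooth_on_ex_derive with (near0 d). }
  assert (HL : locally t (near0 d)) by now apply open_near0.
  assert (K : is_derive (ray_mean k g) t
    (RInt (fun s => Derive (fun z => s ^ k * g (s * z)) t) 0 1)).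
  { apply (is_derive_RInt_param (fun z s => s ^ k * g (s * z)) 0 1 t).
    - apply (filter_imp (near0 d)); [|exact HL]. intros u Hu s Hs.
      rewrite Rmin_left, Rmax_right in Hs by lra.
      eexists. apply Hex. now apply near0_scale.
    - intros s Hs. rewrite Rmin_left, Rmax_right in Hs by lra.
      assert (Hst := near0_scale d s t Hs Ht).
      apply continuity_2d_pt_ext_loc with (fun u v => v ^ S k * Derive g (v * u)).
      + destruct (locally_2d_preimage (near0 d) _ t s (open_near0 d) (continuity_2d_pt_product t s) Hst)
          as [r Hr]. exists r.
        intros u v Hu Hv. symmetry. apply is_derive_unique, Hex. now apply Hr.
      + apply continuity_2d_pt_mean_integrand with d; auto with smooth.
    - apply (filter_imp (near0 d)); [|exact HL]. intros u Hu.
      apply (ex_RInt_continuous (V := R_CompleteNormedModule)).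
      intros s Hs. rewrite Rmin_left, Rmax_right in Hs by lra.
      assert (Hsu := near0_scale d s u Hs Hu).
      apply continuity_pt_filterlim. intros eps Heps.
      destruct (continuity_2d_pt_mean_integrand d k g u s Hg Hsu (mkposreal eps Heps)) as [r Hr].
      exists r. split; [apply cond_pos|]. intros v [_ Hv]. apply Hr; [|exact Hv].
      rewrite Rminus_diag, Rabs_R0. apply cond_pos. }
  replace (ray_mean (S k) (Derive g) t)
    with (RInt (fun s => Derive (fun z => s ^ k * g (s * z)) t) 0 1); [exact K|].
  apply RInt_ext. rewrite Rmin_left, Rmax_right by lra. intros s Hs.
  apply is_derive_unique, Hex, near0_scale; auto. lra.
Qed.

Lemma smooth_on_ray_mean d k g : smooth_on (near0 d) g -> smooth_on (near0 d) (ray_mean k g).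
Proof.
  intros Hg. apply smooth_on_differentiable_n. intros n. revert k g Hg.
  induction n as [|n IH]; intros k g Hg; [apply differentiable_n_0|].
  apply differentiable_n_intro with (ray_mean (S k) (Derive g)); auto with smooth.
  intros t Ht. now apply is_derive_ray_mean with d.
Qed.

(** The quotient is the integral of g'(s t) over s from 0 to 1. *)
Lemma Hadamard d g : smooth_on (near0 d) g -> g 0 = 0 ->
  exists q, smooth_on (near0 d) q /\ forall t, near0 d t -> g t = t * q t.
Proof.
  intros Hg H0. exists (ray_mean 0 (Derive g)). split.
  { apply smooth_on_ray_mean. auto with smooth. }
  intros t Ht.
  assert (K : is_RInt (fun s => t * Derive g (s * t)) 0 1 (minus (g (1 * t)) (g (0 * t)))).
  { apply (is_RInt_derive (V := R_CompleteNormedModule) (fun s => g (s * t))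
      (fun s => t * Derive g (s * t))).
    - rewrite Rmin_left, Rmax_right by lra. intros s Hs.
      assert (Hd := is_derive_dilation g t s).
      rewrite (Rmult_comm t s) in Hd.
      apply is_derive_ext with (fun z => g (t * z)); [intros z; f_equal; ring|].
      apply Hd. apply (smooth_on_ex_derive (near0 d)); auto. now apply near0_scale.
    - rewrite Rmin_left, Rmax_right by lra. intros s Hs.
      apply (continuous_mult (fun _ : R => t) (fun s : R => Derive g (s * t))).
      + apply continuous_const.
      + apply (continuous_comp (fun s : R => s * t) (Derive g)).
        * apply (continuous_mult (fun s : R => s) (fun _ : R => t));
            [apply continuous_id | apply continuous_const].
        * apply (smooth_on_continuous (near0 d)); auto with smooth.
          now apply near0_scale. }
  apply (is_RInt_unique (V := R_CompleteNormedModule)) in K.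
  rewrite Rmult_1_l, Rmult_0_l, H0 in K. unfold minus, plus, opp in K. simpl in K.
  rewrite Ropp_0, Rplus_0_r in K. rewrite <- K.
  unfold ray_mean.
  transitivity (scal t (RInt (fun s => s ^ 0 * Derive g (s * t)) 0 1)); [|reflexivity].
  rewrite <- (RInt_scal (V := R_CompleteNormedModule) (fun s => s ^ 0 * Derive g (s * t)) 0 1 t).
  - apply RInt_ext. intros s _. unfold scal; simpl. unfold mult; simpl. ring.
  - apply (ex_RInt_continuous (V := R_CompleteNormedModule)).
    rewrite Rmin_left, Rmax_right by lra. intros s Hs.
    apply (continuous_mult (fun s : R => s ^ 0) (fun s : R => Derive g (s * t))).
    + apply continuous_const.
    + apply (continuous_comp (fun s : R => s * t) (Derive g)).
      * apply (continuous_mult (fun s : R => s) (fun _ : R => t));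
            [apply continuous_id | apply continuous_const].
      * apply (smooth_on_continuous (near0 d)); auto with smooth.
        now apply near0_scale.
Qed.

(** The Leibniz rule for the product with the variable: at t = 0 it computes
    the derivatives of the quotient in Hadamard's lemma. *)
Lemma Derive_n_mult_id d g q n : smooth_on (near0 d) q ->
  (forall t, near0 d t -> g t = t * q t) ->
  forall t, near0 d t ->
    Derive_n g (S n) t = t * Derive_n q (S n) t + INR (S n) * Derive_n q n t.
Proof.
  intros Hq Hg. induction n as [|n IH]; intros t Ht.
  - simpl. rewrite (Derive_ext_loc g (fun t => t * q t)).
    + rewrite Derive_mult; [rewrite Derive_id; change (Derive (fun x : R => q x)) with (Derive q); simpl; ring| |].
      * apply ex_derive_id.
      * now apply smooth_on_ex_derive with (near0 d).
    + apply (filter_imp (near0 d)); [exact Hg | now apply open_near0].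
  - change (Derive_n g (S (S n)) t) with (Derive (Derive_n g (S n)) t).
    rewrite (Derive_ext_loc _ (fun t => t * Derive_n q (S n) t + INR (S n) * Derive_n q n t));
      [|apply (filter_imp (near0 d)); [exact IH | now apply open_near0]].
    assert (E1 : ex_derive (Derive_n q (S n)) t) by now apply (Hq t Ht (S (S n))).
    assert (E2 : ex_derive (Derive_n q n) t) by now apply (Hq t Ht (S n)).
    rewrite Derive_plus, Derive_mult, Derive_id, Derive_scal.
    + change (Derive (Derive_n q n) t) with (Derive_n q (S n) t).
      change (Derive (Derive_n q (S n)) t) with (Derive_n q (S (S n)) t).
      rewrite (S_INR (S n)). ring.
    + apply ex_derive_id.
    + exact E1.
    + apply (ex_derive_mult (fun t => t)); [apply ex_derive_id | exact E1].
    + now apply (ex_derive_scal (Derive_n q n)).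
Qed.

Definition even_on (d : R) (g : R -> R) : Prop := forall t, near0 d t -> g (- t) = g t.

Lemma Derive_even d g : smooth_on (near0 d) g -> even_on d g ->
  forall t, near0 d t -> Derive g (- t) = - Derive g t.
Proof.
  intros Hg He t Ht.
  assert (Ht' : near0 d (- t)) by (unfold near0 in *; lra).
  rewrite <- (Derive_ext_loc (fun u => g (- u)) g t);
    [|apply (filter_imp (near0 d)); [exact He | now apply open_near0]].
  rewrite (Derive_comp g (fun u => - u)), Derive_opp, Derive_id.
  - ring.
  - now apply smooth_on_ex_derive with (near0 d).
  - apply (ex_derive_opp (fun u : R => u)), ex_derive_id.
Qed.

(** One step towards writing an even function as G(t^2): the derivative of
    G(t^2) is 2 t G'(t^2), so q plays the role of G'(t^2). *)
Lemma even_derivative_quotient d g : 0 < d -> smooth_on (near0 d) g -> even_on d g ->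
  exists q, smooth_on (near0 d) q /\ even_on d q /\
    forall t, near0 d t -> Derive g t = 2 * t * q t.
Proof.
  intros Hd Hg He.
  assert (D0 : Derive g 0 = 0).
  { assert (K := Derive_even d g Hg He 0 ltac:(unfold near0; lra)).
    rewrite Ropp_0 in K. lra. }
  destruct (Hadamard d (Derive g)) as (q & Hq & E); auto with smooth.
  exists (fun t => / 2 * q t). split; [auto with smooth|]. split.
  - intros t Ht. f_equal. destruct (Req_dec t 0) as [->|Hz]; [now rewrite Ropp_0|].
    assert (K := Derive_even d g Hg He t Ht). rewrite E, E in K; [|exact Ht|unfold near0 in *; lra].
    apply Rmult_eq_reg_l with t; [lra | exact Hz].
  - intros t Ht. rewrite E by exact Ht. field.
Qed.

(** * Borel's lemma: smooth functions with prescribed derivatives at a point *)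

(** The (m+1)-fold primitive of cos (l x) that vanishes at 0 with its first m derivatives. *)
Fixpoint sin_primitive (l : R) (m : nat) (x : R) : R :=
  match m with
  | O => sin (l * x) / l
  | S m => RInt (sin_primitive l m) 0 x
  end.

Lemma is_derive_cos_dilation l x : 0 < l ->
  is_derive (sin_primitive l 0) x (cos (l * x)).
Proof. intros Hl. unfold sin_primitive. auto_derive; [exact I|]. field. lra. Qed.

Lemma is_derive_sin_primitive l m x : 0 < l ->
  is_derive (sin_primitive l (S m)) x (sin_primitive l m x).
Proof.
  intros Hl. revert x.
  assert (C : forall m x, continuous (sin_primitive l m) x ->
    (forall y, continuous (sin_primitive l m) y) ->
    is_derive (sin_primitive l (S m)) x (sin_primitive l m x)).
  { intros k x Hc Hcc. apply (is_derive_RInt (V := R_NormedModule) (sin_primitive l k) _ 0 x); [|exact Hc].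
    apply filter_forall. intros b.
    apply (RInt_correct (V := R_CompleteNormedModule) (sin_primitive l k)).
    apply (ex_RInt_continuous (V := R_CompleteNormedModule)). intros z _. apply Hcc. }
  assert (CC : forall k y, continuous (sin_primitive l k) y).
  { intros k. induction k as [|k IH]; intros y.
    - apply (ex_derive_continuous (V := R_NormedModule)). eexists. now apply is_derive_cos_dilation.
    - apply (ex_derive_continuous (V := R_NormedModule)). eexists. apply C; auto. }
  intros x. apply C; auto.
Qed.

Lemma sin_primitive_at_0 l m : sin_primitive l m 0 = 0.
Proof.
  destruct m; simpl.
  - rewrite Rmult_0_r, sin_0. unfold Rdiv. ring.
  - apply (RInt_point (V := R_CompleteNormedModule)).
Qed.

Lemma sin_primitive_bound l m x : 0 < l -> near0 1 x -> Rabs (sin_primitive l m x) <= / l.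
Proof.
  intros Hl. revert x. induction m as [|m IH]; intros x Hx.
  - simpl. unfold Rdiv. rewrite Rabs_mult, (Rabs_inv l), (Rabs_pos_eq l) by lra.
    assert (0 < / l) by now apply Rinv_0_lt_compat.
    assert (Rabs (sin (l * x)) <= 1) by (apply Rabs_le, SIN_bound).
    assert (0 <= Rabs (sin (l * x))) by apply Rabs_pos. nra.
  - destruct (MVT_gen (sin_primitive l (S m)) 0 x (sin_primitive l m)) as (c & Hc & E).
    + intros y _. now apply is_derive_sin_primitive.
    + intros y _. apply continuity_pt_filterlim.
      apply (ex_derive_continuous (V := R_NormedModule)). eexists. now apply is_derive_sin_primitive.
    + rewrite sin_primitive_at_0, !Rminus_0_r in E. rewrite E, Rabs_mult.
      assert (Hc' : near0 1 c).
      { unfold near0 in *. unfold Rmin, Rmax in Hc. destruct (Rle_dec 0 x); lra. }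
      specialize (IH c Hc').
      assert (Rabs x <= 1) by (apply Rabs_le; unfold near0 in *; lra).
      assert (0 <= Rabs x) by apply Rabs_pos.
      assert (0 <= Rabs (sin_primitive l m c)) by apply Rabs_pos. nra.
Qed.

(** With this frequency the primitives of the n-th term of the series are at most 2^-n. *)
Definition frequency (c : R) (n : nat) : R := 2 ^ n * (1 + Rabs c).

Lemma frequency_pos c n : 0 < frequency c n.
Proof.
  unfold frequency. apply Rmult_lt_0_compat; [apply pow_lt; lra|].
  assert (0 <= Rabs c) by apply Rabs_pos. lra.
Qed.

(** The j-th derivative of c times the n-fold primitive of cos (l x). *)
Definition borel_term (c : R) (n j : nat) (x : R) : R :=
  c * if (j <? n)%nat then sin_primitive (frequency c n) (n - j - 1) x
      else Derive_n (fun y => cos (frequency c n * y)) (j - n) x.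

Lemma cos_dilation_smooth l : smooth_on everywhere (fun y => cos (l * y)).
Proof.
  assert (H : forall n D, open D ->
    differentiable_n n D (fun y => cos (l * y)) /\ differentiable_n n D (fun y => sin (l * y))).
  { intros n D HD. induction n as [|n [IHc IHs]]; [split; apply differentiable_n_0|]. split.
    - apply differentiable_n_intro with (fun y => (- l) * sin (l * y)); [exact HD | |].
      + intros y _. auto_derive; [exact I | ring].
      + apply differentiable_n_mult; [exact HD | apply differentiable_n_const | exact IHs].
    - apply differentiable_n_intro with (fun y => l * cos (l * y)); [exact HD | |].
      + intros y _. auto_derive; [exact I | ring].
      + apply differentiable_n_mult; [exact HD | apply differentiable_n_const | exact IHc]. }
  apply smooth_on_differentiable_n. intros n. apply H, open_everywhere.
Qed.

Lemma is_derive_borel_term c n j x : is_derive (borel_term c n j) x (borel_term c n (S j) x).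
Proof.
  assert (Hl := frequency_pos c n). unfold borel_term.
  destruct (j <? n)%nat eqn:E1; [apply Nat.ltb_lt in E1 | apply Nat.ltb_ge in E1].
  - apply (is_derive_scal (sin_primitive (frequency c n) (n - j - 1))).
    destruct (S j <? n)%nat eqn:E2; [apply Nat.ltb_lt in E2 | apply Nat.ltb_ge in E2].
    + replace (n - j - 1)%nat with (S (n - S j - 1)) by lia.
      now apply is_derive_sin_primitive.
    + replace (n - j - 1)%nat with 0%nat by lia. replace (S j - n)%nat with 0%nat by lia.
      now apply is_derive_cos_dilation.
  - replace (S j <? n)%nat with false by (symmetry; apply Nat.ltb_ge; lia).
    apply (is_derive_scal (Derive_n (fun y => cos (frequency c n * y)) (j - n))).
    replace (S j - n)%nat with (S (j - n)) by lia.
    apply Derive_correct.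
    exact (cos_dilation_smooth (frequency c n) x I (S (j - n))).
Qed.

Lemma borel_term_at_0 c n j : (j < n)%nat -> borel_term c n j 0 = 0.
Proof.
  intros H. unfold borel_term. apply Nat.ltb_lt in H. rewrite H, sin_primitive_at_0. ring.
Qed.

Lemma borel_term_diag_at_0 c n : borel_term c n n 0 = c.
Proof.
  unfold borel_term. rewrite Nat.ltb_irrefl, Nat.sub_diag. simpl.
  rewrite Rmult_0_r, cos_0. ring.
Qed.

Lemma borel_term_bound c n j x : (j < n)%nat -> near0 1 x ->
  Rabs (borel_term c n j x) <= (/ 2) ^ n.
Proof.
  intros H Hx. unfold borel_term. apply Nat.ltb_lt in H. rewrite H, Rabs_mult.
  assert (K := sin_primitive_bound (frequency c n) (n - j - 1) x (frequency_pos c n) Hx).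
  assert (Hp : 0 < 2 ^ n) by (apply pow_lt; lra).
  assert (Hc : 0 <= Rabs c) by apply Rabs_pos.
  apply Rle_trans with (Rabs c * / frequency c n).
  - apply Rmult_le_compat_l; auto.
  - unfold frequency. rewrite pow_inv.
    apply Rmult_le_reg_r with (2 ^ n * (1 + Rabs c)); [apply Rmult_lt_0_compat; lra|].
    rewrite Rmult_assoc, Rinv_l by (apply Rgt_not_eq, Rmult_lt_0_compat; lra).
    rewrite <- Rmult_assoc, Rinv_l by lra. lra.
Qed.

Definition borel_sum (c : nat -> R) (j N : nat) (x : R) : R :=
  sum_f_R0 (fun n => borel_term (c n) n j x) N.

Lemma borel_sum_tail c j N k x : (j <= N)%nat -> near0 1 x ->
  Rabs (borel_sum c j (N + k) x - borel_sum c j N x) <= (/ 2) ^ N - (/ 2) ^ (N + k).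
Proof.
  intros HN Hx. induction k as [|k IH].
  - rewrite Nat.add_0_r, !Rminus_diag, Rabs_R0. lra.
  - rewrite Nat.add_succ_r. unfold borel_sum in *. simpl sum_f_R0.
    assert (K := borel_term_bound (c (S (N + k))) (S (N + k)) j x ltac:(lia) Hx).
    match goal with |- Rabs (?s + ?t - ?u) <= _ =>
      replace (s + t - u) with ((s - u) + t) by ring;
      assert (T := Rabs_triang (s - u) t) end.
    simpl pow in *. lra.
Qed.

Lemma borel_sum_CVU c j : CVU_dom (borel_sum c j) (near0 1).
Proof.
  apply CVU_dom_cauchy. intros eps.
  destruct (pow_lt_1_zero (/ 2) ltac:(rewrite Rabs_pos_eq; lra) eps (cond_pos eps)) as [N0 HN0].
  exists (Nat.max j N0).
  assert (W : forall n m x, near0 1 x -> (Nat.max j N0 <= n)%nat -> (n <= m)%nat ->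
    Rabs (borel_sum c j m x - borel_sum c j n x) < eps).
  { intros n m x Hx Hn Hm. replace m with (n + (m - n))%nat by lia.
    assert (T := borel_sum_tail c j n (m - n) x ltac:(lia) Hx).
    assert (K := HN0 n ltac:(lia)). apply Rabs_def2 in K.
    assert (0 < (/ 2) ^ (n + (m - n))) by (apply pow_lt; lra). lra. }
  intros n m x Hx Hn Hm. destruct (Nat.le_ge_cases n m).
  - rewrite Rabs_minus_sym. now apply W.
  - now apply W.
Qed.

Lemma is_derive_borel_sum c j N x :
  is_derive (borel_sum c j N) x (borel_sum c (S j) N x).
Proof.
  induction N as [|N IH].
  - apply is_derive_borel_term.
  - apply (is_derive_plus (V := R_NormedModule) (borel_sum c j N)); [exact IH|].
    apply is_derive_borel_term.
Qed.

Definition borel_limit (c : nat -> R) (j : nat) (x : R) : R :=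
  real (Lim_seq (fun N => borel_sum c j N x)).

Lemma is_derive_borel_limit c j x : near0 1 x ->
  is_derive (borel_limit c j) x (borel_limit c (S j) x).
Proof.
  intros Hx. unfold borel_limit at 2.
  rewrite (Lim_seq_ext _ (fun N => Derive (borel_sum c j N) x)).
  - apply (CVU_Derive (borel_sum c j) (near0 1)); auto.
    + apply open_near0.
    + intros a b y Ha Hb Hy. unfold near0 in *. lra.
    + apply borel_sum_CVU.
    + intros n y _. eexists. apply is_derive_borel_sum.
    + intros n y _. apply continuity_pt_filterlim.
      apply (continuous_ext (borel_sum c (S j) n)).
      * intros z. symmetry. apply is_derive_unique, is_derive_borel_sum.
      * apply (ex_derive_continuous (V := R_NormedModule)). eexists. apply is_derive_borel_sum.
    + apply CVU_dom_cauchy. assert (K := borel_sum_CVU c (S j)).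
      apply CVU_dom_cauchy in K. intros eps. destruct (K eps) as [N HN]. exists N.
      intros n m y Hy Hn Hm.
      rewrite !(is_derive_unique _ _ _ (is_derive_borel_sum c j _ y)). now apply HN.
  - intros N. symmetry. apply is_derive_unique, is_derive_borel_sum.
Qed.

Lemma borel_limit_at_0 c j : borel_limit c j 0 = borel_sum c j j 0.
Proof.
  unfold borel_limit.
  rewrite (Lim_seq_ext_loc _ (fun _ => borel_sum c j j 0)).
  - now rewrite Lim_seq_const.
  - exists j. intros n Hn. induction Hn as [|n Hn IH]; [reflexivity|].
    unfold borel_sum in *. simpl sum_f_R0. rewrite IH, borel_term_at_0 by lia. ring.
Qed.

Lemma course_of_values_recursion (F : nat -> (nat -> R) -> R) :
  (forall j u v, (forall n, (n < j)%nat -> u n = v n) -> F j u = F j v) ->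
  exists c, forall j, c j = F j c.
Proof.
  intros HF.
  set (h := fix h j : nat -> R := match j with
    | O => fun _ => 0
    | S j => fun n => if (n <? j)%nat then h j n else F j (h j) end).
  exists (fun n => h (S n) n).
  assert (E : forall j n, (n < j)%nat -> h j n = h (S n) n).
  { intros j. induction j as [|j IH]; intros n Hn; [lia|].
    destruct (Nat.eq_dec n j) as [->|Hne]; [reflexivity|].
    transitivity (h j n); [|apply IH; lia].
    simpl. now replace (n <? j)%nat with true by (symmetry; apply Nat.ltb_lt; lia). }
  intros j. transitivity (F j (h j)).
  - simpl. now rewrite Nat.ltb_irrefl.
  - apply HF. intros n Hn. now apply E.
Qed.

(** A sum of n-fold primitives of c_n cos (l_n x). The n-th term has derivatives
    0 at 0 up to order n - 1 and c_n at order n, so the c_n can be chosen one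
    after the other to give the derivatives of the sum any values. The l_n grow so
    fast that the differentiated series still converges uniformly. *)
Lemma Borel (a : nat -> R) : exists G : nat -> R -> R,
  (forall k x, near0 1 x -> is_derive (G k) x (G (S k) x)) /\
  (forall k, G k 0 = a k).
Proof.
  destruct (course_of_values_recursion (fun j c =>
    a j - sum_f_R0 (fun n => if (n <? j)%nat then borel_term (c n) n j 0 else 0) j)) as [c Hc].
  { intros j u v E. f_equal. apply sum_eq. intros n _.
    destruct (n <? j)%nat eqn:El; [|reflexivity]. apply Nat.ltb_lt in El. now rewrite E. }
  exists (borel_limit c). split; [intros; now apply is_derive_borel_limit|].
  intros j. rewrite borel_limit_at_0.
  assert (S : borel_sum c j j 0 =
    sum_f_R0 (fun n => if (n <? j)%nat then borel_term (c n) n j 0 else 0) j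
    + borel_term (c j) j j 0).
  { unfold borel_sum. destruct j as [|j]; [simpl; ring|]. simpl sum_f_R0.
    rewrite (Nat.ltb_irrefl (Datatypes.S j)), Rplus_0_r. f_equal.
    apply sum_eq. intros n Hn.
    now replace (n <? Datatypes.S j)%nat with true by (symmetry; apply Nat.ltb_lt; lia). }
  rewrite S, borel_term_diag_at_0. specialize (Hc j). cbv beta in Hc. lra.
Qed.

(** * Whitney's theorem on even functions *)

(** Gluing along 0: when the functions W_k (sqrt x) and G_k x form two towers of
    successive derivatives with the same values at 0, the glued functions do too.
    At 0 the difference quotients from the right are values of W_(k+1) by the
    mean value theorem. *)
Lemma is_derive_glued_sqrt d (W0 W1 G0 G1 : R -> R) :
  0 < d <= 1 -> smooth_on (near0 d) W0 -> smooth_on (near0 d) W1 ->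
  (forall t, near0 d t -> Derive W0 t = 2 * t * W1 t) ->
  (forall x, near0 1 x -> is_derive G0 x (G1 x)) ->
  G0 0 = W0 0 -> G1 0 = W1 0 ->
  forall x, near0 (d * d) x ->
    is_derive (fun x => if Rlt_dec 0 x then W0 (sqrt x) else G0 x) x
      (if Rlt_dec 0 x then W1 (sqrt x) else G1 x).
Proof.
  intros Hd HW0 HW1 EW HG E0 E1 x Hx.
  assert (Sq : forall y, 0 <= y < d * d -> near0 d (sqrt y)).
  { intros y Hy. assert (0 <= sqrt y) by apply sqrt_pos.
    assert (sqrt y * sqrt y = y) by (apply sqrt_sqrt; lra). unfold near0. nra. }
  assert (Dp : forall y, 0 < y < d * d -> is_derive (fun z => W0 (sqrt z)) y (W1 (sqrt y))).
  { intros y Hy. assert (0 < sqrt y) by (apply sqrt_lt_R0; lra).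
    assert (K := Sq y ltac:(lra)).
    replace (W1 (sqrt y)) with (1 / (2 * sqrt y) * Derive W0 (sqrt y))
      by (rewrite (EW _ K); field; lra).
    apply (is_derive_comp (V := R_NormedModule) W0 sqrt).
    - apply Derive_correct. now apply smooth_on_ex_derive with (near0 d).
    - apply (is_derive_sqrt (fun z => z)); [|lra]. exact (is_derive_id (K := R_AbsRing) y). }
  destruct (Rtotal_order x 0) as [Hn|[->|Hp]].
  - destruct (Rlt_dec 0 x); [lra|].
    apply is_derive_ext_loc with G0; [|apply HG; unfold near0 in *; nra].
    apply (filter_imp (fun z => z < 0)); [|now apply (open_lt 0)].
    intros z Hz. now destruct (Rlt_dec 0 z); [lra|].
  - destruct (Rlt_dec 0 0); [lra|].
    apply is_derive_Reals. intros eps Heps.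
    destruct (proj1 (is_derive_Reals _ _ _) (HG 0 ltac:(unfold near0; lra)) eps Heps) as [d1 H1].
    assert (Cc : continuous (fun z => W1 (sqrt z)) 0).
    { apply (continuous_comp sqrt W1).
      - apply continuity_pt_filterlim, continuity_pt_sqrt. lra.
      - rewrite sqrt_0. apply smooth_on_continuous with (near0 d); [exact HW1|unfold near0; lra]. }
    assert (Hl : locally 0 (fun z => W1 (sqrt 0) - eps < W1 (sqrt z) < W1 (sqrt 0) + eps)).
    { apply (Cc (fun w => W1 (sqrt 0) - eps < w < W1 (sqrt 0) + eps)).
      refine (open_between (W1 (sqrt 0) - eps) (W1 (sqrt 0) + eps) (W1 (sqrt 0)) _). lra. }
    apply locally_R in Hl. destruct Hl as (d2 & Hd2 & H2). rewrite sqrt_0 in H2.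
    assert (Hm : 0 < Rmin d1 (Rmin d2 (d * d))).
    { repeat apply Rmin_glb_lt; [apply cond_pos | exact Hd2 | nra]. }
    exists (mkposreal _ Hm). intros h Hh Hhb. simpl in Hhb.
    assert (M1 : Rmin d1 (Rmin d2 (d * d)) <= d1) by apply Rmin_l.
    assert (M2 : Rmin d1 (Rmin d2 (d * d)) <= Rmin d2 (d * d)) by apply Rmin_r.
    assert (M3 : Rmin d2 (d * d) <= d2) by apply Rmin_l.
    assert (M4 : Rmin d2 (d * d) <= d * d) by apply Rmin_r.
    destruct (Rlt_dec 0 0); [lra|]. rewrite Rplus_0_l.
    destruct (Rlt_dec 0 h) as [Hp|Hp].
    + rewrite Rabs_pos_eq in Hhb by lra.
      destruct (MVT_gen (fun z => W0 (sqrt z)) 0 h (fun z => W1 (sqrt z))) as (c & Hc & E).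
      * rewrite Rmin_left, Rmax_right by lra. intros z Hz. apply Dp. lra.
      * rewrite Rmin_left, Rmax_right by lra. intros z Hz.
        apply continuity_pt_filterlim, (continuous_comp sqrt W0).
        -- apply continuity_pt_filterlim, continuity_pt_sqrt. lra.
        -- apply smooth_on_continuous with (near0 d); [exact HW0|]. apply Sq. lra.
      * rewrite Rmin_left, Rmax_right in Hc by lra. rewrite sqrt_0 in E.
        rewrite E0, E1, E. replace (W1 (sqrt c) * (h - 0) / h) with (W1 (sqrt c)) by (field; lra).
        assert (K := H2 c ltac:(lra)). apply Rabs_def1; lra.
    + specialize (H1 h Hh ltac:(lra)). now rewrite Rplus_0_l in H1.
  - destruct (Rlt_dec 0 x); [|lra].
    apply is_derive_ext_loc with (fun z => W0 (sqrt z)); [|apply Dp; unfold near0 in *; lra].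
    apply (filter_imp (fun z => 0 < z)); [|now apply (open_gt 0)].
    intros z Hz. now destruct (Rlt_dec 0 z); [|lra].
Qed.

(** For x > 0 the function must be W (sqrt x), and it is smooth up to 0 with
    derivatives there given by iterating [even_derivative_quotient]; Borel's lemma
    supplies a smooth function with these derivatives for x < 0. *)
Lemma Whitney_even d W : 0 < d <= 1 -> smooth_on (near0 d) W -> even_on d W ->
  exists E, smooth_on (near0 (d * d)) E /\ forall t, near0 d t -> W t = E (t * t).
Proof.
  intros Hd HW He.
  set (good g := smooth_on (near0 d) g /\ even_on d g).
  (* The relation holds vacuously where g is not good, so that every g has a successor. *)
  set (next g q := good g -> good q /\ forall t, near0 d t -> Derive g t = 2 * t * q t).
  assert (Hnext : forall g, exists q, next g q).
  { intros g. destruct (classic (good g)) as [[H1 H2]|H]; [|exists g; intros H'; now destruct H].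
    destruct (even_derivative_quotient d g) as (q & Q1 & Q2 & Q3); auto; [lra|].
    exists q. intros _. now split. }
  set (Wk := fix Wk k := match k with
    | O => W
    | S k => epsilon (inhabits W) (next (Wk k)) end).
  assert (Hspec : forall k, next (Wk k) (Wk (S k))).
  { intros k. exact (epsilon_spec (inhabits W) _ (Hnext (Wk k))). }
  assert (Hgood : forall k, good (Wk k)).
  { intros k. induction k as [|k IH]; [now split | exact (proj1 (Hspec k IH))]. }
  destruct (Borel (fun k => Wk k 0)) as (G & HG & HG0).
  set (E k x := if Rlt_dec 0 x then Wk k (sqrt x) else G k x).
  exists (E 0%nat). split.
  - assert (HE : forall n k, differentiable_n n (near0 (d * d)) (E k)).
    { induction n as [|n IH]; intros k; [apply differentiable_n_0|].
      apply differentiable_n_intro with (E (S k)); [apply open_near0 | | apply IH].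
      apply (is_derive_glued_sqrt d); auto; try apply Hgood. now apply (Hspec k). }
    apply smooth_on_differentiable_n. auto.
  - intros t Ht. unfold E. destruct (Rlt_dec 0 (t * t)) as [Hp|Hp].
    + change (Wk 0%nat) with W. fold (Rsqr t). rewrite sqrt_Rsqr_abs.
      unfold Rabs. destruct (Rcase_abs t); [now rewrite He | reflexivity].
    + replace t with 0 by nra. rewrite Rmult_0_l, HG0. reflexivity.
Qed.

Lemma Whitney_even_odd d W : 0 < d -> smooth_on (near0 d) W ->
  exists e E O, 0 < e /\ smooth_on (near0 (e * e)) E /\ smooth_on (near0 (e * e)) O /\
    forall t, near0 e t -> near0 d t /\ W t = E (t * t) + t * O (t * t).
Proof.
  intros Hd HW. set (e := Rmin d 1).
  assert (He : 0 < e <= 1) by (split; [apply Rmin_glb_lt; lra | apply Rmin_r]).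
  assert (Hed : e <= d) by apply Rmin_l.
  assert (Hsub : forall t, near0 e t -> near0 d t) by (unfold near0; intros; lra).
  assert (HWe : smooth_on (near0 e) W) by now apply smooth_on_sub with (near0 d).
  assert (HWn : smooth_on (near0 e) (fun t => W (- t))).
  { apply smooth_on_comp with (near0 e); auto with smooth. unfold near0. intros; lra. }
  destruct (Whitney_even e (fun t => / 2 * (W t + W (- t)))) as (E & HE & EE); auto with smooth.
  { intros t _. rewrite Ropp_involutive. ring. }
  destruct (Hadamard e (fun t => / 2 * (W t - W (- t)))) as (V & HV & EV); auto with smooth.
  { rewrite Ropp_0. ring. }
  destruct (Whitney_even e V) as (O & HO & EO); auto.
  { intros t Ht. destruct (Req_dec t 0) as [->|Hz]; [now rewrite Ropp_0|].
    assert (K1 := EV t Ht). assert (K2 := EV (- t) ltac:(unfold near0 in *; lra)).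
    rewrite Ropp_involutive in K2. apply Rmult_eq_reg_l with t; [lra | exact Hz]. }
  exists e, E, O. split; [lra|]. split; [exact HE|]. split; [exact HO|].
  intros t Ht. split; [auto|].
  rewrite <- (EE t), <- (EO t), <- (EV t) by auto. field.
Qed.

(** * The normal form of an ordinary cusp *)

Lemma continuity_2d_pt_affine p q r x y :
  continuity_2d_pt (fun u v => p * u + q * v + r) x y.
Proof.
  apply continuity_2d_pt_plus; [|apply continuity_2d_pt_const].
  apply continuity_2d_pt_plus; apply continuity_2d_pt_mult;
    auto using continuity_2d_pt_const, continuity_2d_pt_id1, continuity_2d_pt_id2.
Qed.

(** The maps of this form contain the components of all the plane diffeomorphisms
    needed below, and both partial derivatives of such a map have the same form. *)
Lemma ex_diff_n_affine_in_second (D : R -> Prop) p q r p' q' r' n : open D -> forall A B,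
  smooth_on D A -> smooth_on D B -> forall x y, D (p * x + q * y + r) ->
  ex_diff_n (fun x y => (p' * x + q' * y + r') * A (p * x + q * y + r)
                        + B (p * x + q * y + r)) n x y.
Proof.
  intros HD. induction n as [|n IH]; intros A B HA HB x y Hxy.
  all: assert (Hc : continuity_2d_pt (fun x y => (p' * x + q' * y + r') * A (p * x + q * y + r)
                        + B (p * x + q * y + r)) x y).
  1, 3: apply continuity_2d_pt_plus; [apply continuity_2d_pt_mult; [apply continuity_2d_pt_affine|]|].
  1, 3: apply (continuity_1d_2d_pt_comp A (fun u v => p * u + q * v + r)); [|apply continuity_2d_pt_affine].
  1, 2: apply continuity_pt_filterlim; now apply smooth_on_continuous with D.
  1, 2: apply (continuity_1d_2d_pt_comp B (fun u v => p * u + q * v + r)); [|apply continuity_2d_pt_affine].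
  1, 2: apply continuity_pt_filterlim; now apply smooth_on_continuous with D.
  - split; [exact Hc | exact I].
  - assert (D1 : forall u v, D (p * u + q * v + r) ->
      is_derive (fun z => (p' * z + q' * v + r') * A (p * z + q * v + r)
                          + B (p * z + q * v + r)) u
        ((p' * u + q' * v + r') * (p * Derive A (p * u + q * v + r))
         + (p' * A (p * u + q * v + r) + p * Derive B (p * u + q * v + r)))).
    { intros u v Huv. auto_derive.
      - repeat split; now apply smooth_on_ex_derive with D.
      - change (Derive (fun x : R => A x)) with (Derive A).
        change (Derive (fun x : R => B x)) with (Derive B). ring. }
    assert (D2 : forall u v, D (p * u + q * v + r) ->
      is_derive (fun z => (p' * u + q' * z + r') * A (p * u + q * z + r)
                          + B (p * u + q * z + r)) v
        ((p' * u + q' * v + r') * (q * Derive A (p * u + q * v + r))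
         + (q' * A (p * u + q * v + r) + q * Derive B (p * u + q * v + r)))).
    { intros u v Huv. auto_derive.
      - repeat split; now apply smooth_on_ex_derive with D.
      - change (Derive (fun x : R => A x)) with (Derive A).
        change (Derive (fun x : R => B x)) with (Derive B). ring. }
    assert (HL := locally_2d_preimage D _ x y HD (continuity_2d_pt_affine p q r x y) Hxy).
    split; [exact Hc|]. split; [|split; [|split]].
    + eexists. now apply D1.
    + eexists. now apply D2.
    + apply ex_diff_n_ext_loc with (fun u v =>
        (p' * u + q' * v + r') * (p * Derive A (p * u + q * v + r))
         + (p' * A (p * u + q * v + r) + p * Derive B (p * u + q * v + r))).
      * destruct HL as [e HL]. exists e. intros u v Hu Hv.
        symmetry. apply is_derive_unique, D1. now apply HL.
      * apply (IH (fun z => p * Derive A z) (fun z => p' * A z + p * Derive B z)); auto with smooth.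
    + apply ex_diff_n_ext_loc with (fun u v =>
        (p' * u + q' * v + r') * (q * Derive A (p * u + q * v + r))
         + (q' * A (p * u + q * v + r) + q * Derive B (p * u + q * v + r))).
      * destruct HL as [e HL]. exists e. intros u v Hu Hv.
        symmetry. apply is_derive_unique, D2. now apply HL.
      * apply (IH (fun z => q * Derive A z) (fun z => q' * A z + q * Derive B z)); auto with smooth.
Qed.

Lemma ex_diff_n_of_affine_in_second (F : R -> R -> R) (D : R -> Prop) p q r p' q' r' A B x y :
  open D -> smooth_on D A -> smooth_on D B -> D (p * x + q * y + r) ->
  (forall u v, D (p * u + q * v + r) ->
     F u v = (p' * u + q' * v + r') * A (p * u + q * v + r) + B (p * u + q * v + r)) ->
  forall n, ex_diff_n F n x y.
Proof.
  intros HD HA HB Hxy E n.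
  apply ex_diff_n_ext_loc with (fun x y => (p' * x + q' * y + r') * A (p * x + q * y + r)
                        + B (p * x + q * y + r)).
  - destruct (locally_2d_preimage D _ x y HD (continuity_2d_pt_affine p q r x y) Hxy) as [e HL].
    exists e. intros u v Hu Hv. symmetry. apply E. now apply HL.
  - now apply ex_diff_n_affine_in_second with D.
Qed.

Lemma factor_square g : smooth_on everywhere g -> g 0 = 0 -> Derive_n g 1 0 = 0 ->
  exists X, smooth_on (near0 1) X /\ X 0 = Derive_n g 2 0 / 2 /\
    forall t, near0 1 t -> g t = t ^ 2 * X t.
Proof.
  intros Hg g0 g1.
  assert (Hg' : smooth_on (near0 1) g) by (apply smooth_on_sub with everywhere; [intros; exact I | exact Hg]).
  assert (Z : near0 1 0) by (unfold near0; lra).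
  destruct (Hadamard 1 g Hg' g0) as (q & Hq & Eq).
  assert (K := fun n => Derive_n_mult_id 1 g q n Hq Eq 0 Z).
  assert (q0 : q 0 = 0) by (specialize (K 0%nat); rewrite g1 in K; simpl in K; lra).
  destruct (Hadamard 1 q Hq q0) as (X & HX & EX).
  assert (L := Derive_n_mult_id 1 q X 0 HX EX 0 Z).
  specialize (K 1%nat). rewrite L in K.
  exists X. split; [exact HX|]. split.
  - rewrite K. simpl. field.
  - intros t Ht. rewrite Eq, EX by exact Ht. ring.
Qed.

Lemma factor_cube g : smooth_on everywhere g -> g 0 = 0 -> Derive_n g 1 0 = 0 ->
  Derive_n g 2 0 = 0 ->
  exists Y, smooth_on (near0 1) Y /\ Y 0 = Derive_n g 3 0 / 6 /\
    forall t, near0 1 t -> g t = t ^ 3 * Y t.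
Proof.
  intros Hg g0 g1 g2.
  assert (Hg' : smooth_on (near0 1) g) by (apply smooth_on_sub with everywhere; [intros; exact I | exact Hg]).
  assert (Z : near0 1 0) by (unfold near0; lra).
  destruct (Hadamard 1 g Hg' g0) as (q & Hq & Eq).
  assert (K := fun n => Derive_n_mult_id 1 g q n Hq Eq 0 Z).
  assert (q0 : q 0 = 0) by (specialize (K 0%nat); rewrite g1 in K; simpl in K; lra).
  destruct (Hadamard 1 q Hq q0) as (X & HX & EX).
  assert (L := fun n => Derive_n_mult_id 1 q X n HX EX 0 Z).
  assert (X0 : X 0 = 0).
  { assert (K1 := K 1%nat). rewrite (L 0%nat), g2 in K1. simpl in K1. lra. }
  destruct (Hadamard 1 X HX X0) as (Y & HY & EY).
  assert (M := Derive_n_mult_id 1 X Y 0 HY EY 0 Z).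
  specialize (K 2%nat). rewrite (L 1%nat), M in K.
  exists Y. split; [exact HY|]. split.
  - rewrite K. simpl. field.
  - intros t Ht. rewrite Eq, EX, EY by exact Ht. ring.
Qed.

Lemma near0_shrink d d' : 0 < d -> 0 < d' ->
  exists e, 0 < e /\ (forall t, near0 e t -> near0 d t) /\ (forall t, near0 e t -> near0 d' t).
Proof.
  intros H H'. exists (Rmin d d'). split; [now apply Rmin_glb_lt|].
  assert (Rmin d d' <= d) by apply Rmin_l. assert (Rmin d d' <= d') by apply Rmin_r.
  split; unfold near0; intros; lra.
Qed.

Lemma locally_near0 (P : R -> Prop) : locally 0 P -> exists d, 0 < d /\ forall t, near0 d t -> P t.
Proof.
  intros H. apply locally_R in H. destruct H as (d & Hd & H). exists d. split; [exact Hd|].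
  intros t Ht. apply H. unfold near0 in Ht. lra.
Qed.

Lemma near0_locally (P : R -> Prop) d : 0 < d -> (forall t, near0 d t -> P t) -> locally 0 P.
Proof.
  intros Hd H. apply locally_R. exists d. split; [exact Hd|]. intros y Hy. apply H.
  unfold near0. lra.
Qed.

Lemma smooth_positive_near0 d X : 0 < d -> smooth_on (near0 d) X -> 0 < X 0 ->
  exists e, 0 < e /\ (forall t, near0 e t -> near0 d t) /\ (forall t, near0 e t -> 0 < X t).
Proof.
  intros Hd HX H0. assert (Z : near0 d 0) by (unfold near0; lra).
  assert (HL : locally 0 (fun t => 0 < X t)).
  { apply (smooth_on_continuous (near0 d) X 0 HX Z (fun w => 0 < w)). now apply (open_gt 0). }
  destruct (locally_near0 _ HL) as (e' & He' & H).
  destruct (near0_shrink d e' Hd He') as (e & He & H1 & H2).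
  exists e. auto.
Qed.

Ltac near := unfold near0 in *; lra.

(** With rho (t) = t sqrt (X t) as parameter, t^2 X becomes the square of the
    parameter and t^3 Y a cube times a unit, which is split by Whitney's theorem. *)
Lemma cusp_parameter X Y : smooth_on (near0 1) X -> smooth_on (near0 1) Y -> X 0 = 1 -> Y 0 = 1 ->
  exists (d : R) (phi rho E O : R -> R), 0 < d /\ phi 0 = 0 /\
    smooth_on (near0 d) phi /\ smooth_on (near0 d) rho /\
    smooth_on (near0 d) E /\ smooth_on (near0 d) O /\
    (forall x, near0 d x -> E x <> 0) /\
    (forall t, near0 d t -> phi (rho t) = t) /\
    (forall s, near0 d s -> rho (phi s) = s /\ near0 1 (phi s) /\ near0 d (s ^ 2) /\
       phi s ^ 2 * X (phi s) = s ^ 2 /\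
       phi s ^ 3 * Y (phi s) = s ^ 3 * (E (s ^ 2) + s * O (s ^ 2))).
Proof.
  intros HX HY X0 Y0.
  destruct (smooth_positive_near0 1 X) as (d & Hd & Hd1 & Xpos); auto; try lra.
  set (rho := fun t => t * sqrt (X t)).
  assert (HXd : smooth_on (near0 d) X) by now apply smooth_on_sub with (near0 1).
  assert (Hsq : smooth_on (near0 d) (fun t => sqrt (X t)))
    by (apply smooth_on_sqrt; auto with smooth).
  assert (Hrho : smooth_on (near0 d) rho) by (unfold rho; auto with smooth).
  assert (Z : near0 d 0) by (unfold near0; lra).
  assert (rho0 : rho 0 = 0) by (unfold rho; ring).
  assert (Drho : Derive rho 0 = 1).
  { assert (K := Derive_n_mult_id d rho (fun t => sqrt (X t)) 0 Hsq (fun t _ => eq_refl) 0 Z).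
    change (Derive rho 0) with (Derive_n rho 1 0). rewrite K. simpl.
    rewrite X0, sqrt_1. ring. }
  destruct (inverse_function (near0 d) rho 0) as (phi & r & e & Hr & He & Hphi & Hv & Hu);
    auto with smooth; [lra|].
  rewrite rho0 in Hphi, Hv.
  assert (Hphi' : smooth_on (near0 r) phi).
  { apply smooth_on_sub with (2 := Hphi). unfold near0. intros; lra. }
  assert (Hv' : forall y, near0 r y -> near0 d (phi y) /\ rho (phi y) = y).
  { intros y Hy. apply Hv. unfold near0 in Hy. lra. }
  assert (phi0 : phi 0 = 0) by (rewrite <- rho0 at 1; apply Hu; lra).
  assert (HYd : smooth_on (near0 d) Y) by now apply smooth_on_sub with (near0 1).
  set (W := fun s => Y (phi s) / sqrt (X (phi s)) ^ 3).
  assert (HW : smooth_on (near0 r) W).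
  { unfold W. apply smooth_on_div; auto with smooth.
    - intros s Hs. apply pow_nonzero.
      assert (0 < sqrt (X (phi s))) by (apply sqrt_lt_R0, Xpos, Hv'; exact Hs). lra.
    - apply smooth_on_comp with (near0 d); auto with smooth. intros s Hs. now apply Hv'.
    - apply smooth_on_pow; [auto with smooth|].
      apply (smooth_on_comp (near0 r) (near0 d) (fun t => sqrt (X t))); auto with smooth.
      intros s Hs. now apply Hv'. }
  destruct (Whitney_even_odd r W Hr HW) as (k & E & O & Hk & HE & HO & EW).
  assert (E00 : E 0 = 1).
  { destruct (EW 0 ltac:(near)) as [_ K]. unfold W in K.
    rewrite phi0, X0, Y0, sqrt_1, !Rmult_0_l in K. lra. }
  destruct (smooth_positive_near0 (k * k) E) as (l & Hl & Hlk & Epos); auto; [nra | lra |].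
  set (d0 := Rmin (Rmin (Rmin l 1) (Rmin k e)) (Rmin d r)).
  assert (Hd0 : 0 < d0 /\ d0 <= l /\ d0 <= 1 /\ d0 <= k /\ d0 <= e /\ d0 <= d /\ d0 <= r).
  { unfold d0, Rmin. repeat destruct (Rle_dec _ _); repeat split; lra. }
  clearbody d0. destruct Hd0 as (? & ? & ? & ? & ? & ? & ?).
  exists d0, phi, rho, E, O.
  split; [assumption|]. split; [exact phi0|].
  split; [apply smooth_on_sub with (2 := Hphi'); intros; near|].
  split; [apply smooth_on_sub with (2 := Hrho); intros; near|].
  split; [apply smooth_on_sub with (2 := HE); intros; apply Hlk; near|].
  split; [apply smooth_on_sub with (2 := HO); intros; apply Hlk; near|].
  split; [intros x Hx; assert (K := Epos x ltac:(near)); lra|].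
  split; [intros t Ht; apply Hu; near|].
  intros s Hs. destruct (Hv' s ltac:(near)) as [V1 V2].
  destruct (EW s ltac:(near)) as [_ W1].
  assert (Xp := Xpos _ V1). assert (Sp := sqrt_lt_R0 _ Xp).
  assert (SS : sqrt (X (phi s)) * sqrt (X (phi s)) = X (phi s)) by (apply sqrt_sqrt; lra).
  split; [exact V2|]. split; [apply Hd1, V1|]. split; [unfold near0 in *; nra|].
  replace (s ^ 2) with (s * s) by ring. unfold rho in V2. split.
  - transitivity ((phi s * sqrt (X (phi s))) * (phi s * sqrt (X (phi s)))); [|now rewrite V2].
    rewrite <- SS at 1. ring.
  - rewrite <- W1. unfold W.
    transitivity ((phi s * sqrt (X (phi s))) ^ 3 * (Y (phi s) / sqrt (X (phi s)) ^ 3)).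
    + field. lra.
    + now rewrite V2.
Qed.

Lemma Derive_n_affine_translate (f g : R -> R) p q r t0 :
  smooth_on everywhere f -> smooth_on everywhere g -> forall n t,
  Derive_n (fun t => p * f (t0 + t) + q * g (t0 + t) + r) (S n) t =
  p * Derive_n f (S n) (t0 + t) + q * Derive_n g (S n) (t0 + t).
Proof.
  intros Hf Hg n.
  assert (T : forall (u : R -> R) t, ex_derive u (t0 + t) ->
    is_derive (fun t => u (t0 + t)) t (Derive u (t0 + t))).
  { intros u t Hu. auto_derive; [exact Hu|].
    change (Derive (fun x : R => u x)) with (Derive u). ring. }
  assert (E : forall n t, is_derive (fun t => p * Derive_n f n (t0 + t) + q * Derive_n g n (t0 + t)) t
     (p * Derive_n f (S n) (t0 + t) + q * Derive_n g (S n) (t0 + t))).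
  { intros m t. apply (is_derive_plus (V := R_NormedModule)).
    - apply (is_derive_scal (fun t => Derive_n f m (t0 + t))), T. exact (Hf (t0 + t) I (S m)).
    - apply (is_derive_scal (fun t => Derive_n g m (t0 + t))), T. exact (Hg (t0 + t) I (S m)). }
  induction n as [|n IH]; intros t.
  - apply is_derive_unique.
    assert (K := is_derive_plus (V := R_NormedModule) _ _ t _ _ (E 0%nat t)
      (is_derive_const (V := R_NormedModule) r t)).
    rewrite plus_zero_r in K. exact K.
  - change (Derive_n ?h (S (S n)) t) with (Derive (Derive_n h (S n)) t).
    rewrite (Derive_ext _ _ t IH). apply is_derive_unique, E.
Qed.

(** In affine coordinates x, y along C''(t0) and C'''(t0), the parameter of
    [cusp_parameter] turns the curve into (s^2, s^3 (E (s^2) + s O (s^2))), and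
    (x, y) |-> (x, (y - x^2 O x) / E x) straightens this into (s^2, s^3). *)
Lemma cusp_of_independent_derivatives (C : R -> plane) (t0 : R) :
  smooth_curve C -> deriv 1 C t0 = (0, 0) ->
  det2 (deriv 2 C t0) (deriv 3 C t0) <> 0 -> cusp C t0.
Proof.
  intros HC H1 Hdet. split; [exact H1|].
  set (f := fun u => fst (C u)). set (g := fun u => snd (C u)).
  assert (Hf : smooth_on everywhere f) by (intros t _; apply HC).
  assert (Hg : smooth_on everywhere g) by (intros t _; apply HC).
  set (a1 := Derive_n f 2 t0 / 2). set (a2 := Derive_n g 2 t0 / 2).
  set (b1 := Derive_n f 3 t0 / 6). set (b2 := Derive_n g 3 t0 / 6).
  set (D := a1 * b2 - a2 * b1).
  assert (HD : D <> 0).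
  { intros E. apply Hdet. 
    change (Derive_n f 2 t0 * Derive_n g 3 t0 - Derive_n g 2 t0 * Derive_n f 3 t0 = 0).
    transitivity (12 * D); [unfold D, a1, a2, b1, b2; field | rewrite E; ring]. }
  assert (F1 : Derive_n f 1 t0 = 0 /\ Derive_n g 1 t0 = 0).
  { unfold deriv in H1. fold f g in H1. injection H1. auto. }
  assert (Ef2 : Derive_n f 2 t0 = 2 * a1) by (unfold a1; field).
  assert (Eg2 : Derive_n g 2 t0 = 2 * a2) by (unfold a2; field).
  assert (Ef3 : Derive_n f 3 t0 = 6 * b1) by (unfold b1; field).
  assert (Eg3 : Derive_n g 3 t0 = 6 * b2) by (unfold b2; field).
  clearbody a1 a2 b1 b2. destruct F1 as [Ef1 Eg1].
  set (c1 := f t0). set (c2 := g t0).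
  set (r1 := - (b2 * c1 - b1 * c2) / D). set (r2 := - (a1 * c2 - a2 * c1) / D).
  set (l1 := fun x y => b2 / D * x + - b1 / D * y + r1).
  set (l2 := fun x y => - a2 / D * x + a1 / D * y + r2).
  set (x := fun t => b2 / D * f (t0 + t) + - b1 / D * g (t0 + t) + r1).
  set (y := fun t => - a2 / D * f (t0 + t) + a1 / D * g (t0 + t) + r2).
  assert (Ht0 : forall u, smooth_on everywhere u -> smooth_on everywhere (fun t => u (t0 + t))).
  { intros u Hu. apply smooth_on_comp with everywhere; auto with smooth. }
  assert (Hx : smooth_on everywhere x) by (unfold x; auto 8 with smooth).
  assert (Hy : smooth_on everywhere y) by (unfold y; auto 8 with smooth).
  destruct (factor_square x Hx) as (X & HX & X0 & EX).
  { unfold x. rewrite Rplus_0_r. fold c1 c2. unfold r1. field. exact HD. }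
  { unfold x. rewrite Derive_n_affine_translate, Rplus_0_r, Ef1, Eg1 by assumption. ring. }
  destruct (factor_cube y Hy) as (Y & HY & Y0 & EY).
  { unfold y. rewrite Rplus_0_r. fold c1 c2. unfold r2. field. exact HD. }
  { unfold y. rewrite Derive_n_affine_translate, Rplus_0_r, Ef1, Eg1 by assumption. ring. }
  { unfold y. rewrite Derive_n_affine_translate, Rplus_0_r, Ef2, Eg2 by assumption. field. exact HD. }
  assert (X1 : X 0 = 1).
  { rewrite X0. unfold x. rewrite Derive_n_affine_translate, Rplus_0_r, Ef2, Eg2 by assumption.
    transitivity (D / D); [unfold D; field | field]; exact HD. }
  assert (Y1 : Y 0 = 1).
  { rewrite Y0. unfold y. rewrite Derive_n_affine_translate, Rplus_0_r, Ef3, Eg3 by assumption.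
    transitivity (D / D); [unfold D; field | field]; exact HD. }
  destruct (cusp_parameter X Y HX HY X1 Y1)
    as (d & phi & rho & E & O & Hd & phi0 & Hphi & Hrho & HE & HO & Enz & Hpr & Hmain).
  set (Phi := fun z : plane => (l1 (fst z) (snd z),
    (l2 (fst z) (snd z) - l1 (fst z) (snd z) ^ 2 * O (l1 (fst z) (snd z))) / E (l1 (fst z) (snd z)))).
  (* Psi is the inverse of Phi: it undoes the straightening, then the change of coordinates. *)
  set (Psi := fun w : plane =>
    (c1 + fst w * a1 + (snd w * E (fst w) + fst w ^ 2 * O (fst w)) * b1,
     c2 + fst w * a2 + (snd w * E (fst w) + fst w ^ 2 * O (fst w)) * b2)).
  assert (L1 : forall p q, l1 (c1 + p * a1 + q * b1) (c2 + p * a2 + q * b2) = p).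
  { intros p q. unfold l1, r1. transitivity (p * D / D); [unfold D; field | field]; exact HD. }
  assert (L2 : forall p q, l2 (c1 + p * a1 + q * b1) (c2 + p * a2 + q * b2) = q).
  { intros p q. unfold l2, r2. transitivity (q * D / D); [unfold D; field | field]; exact HD. }
  assert (M1 := L1 0 0). assert (M2 := L2 0 0).
  rewrite !Rmult_0_l, !Rplus_0_r in M1, M2.
  assert (L3 : forall u v, c1 + l1 u v * a1 + l2 u v * b1 = u).
  { intros u v. unfold l1, l2, r1, r2. transitivity (u * D / D); [unfold D; field | field]; exact HD. }
  assert (L4 : forall u v, c2 + l1 u v * a2 + l2 u v * b2 = v).
  { intros u v. unfold l1, l2, r1, r2. transitivity (v * D / D); [unfold D; field | field]; exact HD. }
  assert (HEi : smooth_on (near0 d) (fun z => / E z)) by (apply smooth_on_inv; auto with smooth).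
  exists (fun s => t0 + phi s), Phi. split; [|split].
  - split; [rewrite phi0; ring|].
    exists (fun u => rho (u - t0)). split.
    + apply near0_locally with d; [exact Hd|]. intros s Hs. split.
      * assert (K : smooth_on (near0 d) (fun s => t0 + phi s)) by auto with smooth.
        now apply K.
      * replace (t0 + phi s - t0) with (phi s) by ring. now apply Hmain.
    + apply locally_R. exists d. split; [exact Hd|]. intros u Hu. split.
      * assert (K : smooth_on (fun u => t0 - d < u < t0 + d) (fun u => rho (u - t0))).
        { apply smooth_on_comp with (near0 d); auto with smooth. intros; near. }
        now apply K.
      * rewrite Hpr by near. ring.
  - split.
    { unfold Phi. change (fst (C t0)) with c1. change (snd (C t0)) with c2.
      rewrite M1, M2. f_equal. assert (K := Enz 0 ltac:(near)). field. exact K. }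
    exists Psi. split.
    + assert (K : locally (c1, c2) (fun z : R * R => near0 d (l1 (fst z) (snd z)))).
      { apply (locally_2d_locally (fun u v => near0 d (l1 u v))).
        apply locally_2d_preimage; [apply open_near0 | apply continuity_2d_pt_affine | rewrite M1; near]. }
      assert (EC : C t0 = (c1, c2)) by (unfold c1, c2, f, g; now destruct (C t0)).
      rewrite EC. revert K. apply filter_imp. intros [u v] Hz. simpl in Hz. split.
      * intros n. simpl. split.
        -- apply (ex_diff_n_of_affine_in_second _ (near0 d) (b2 / D) (- b1 / D) r1 0 0 0
             (fun _ => 0) (fun z => z)); auto with smooth.
           intros; unfold l1; ring.
        -- apply (ex_diff_n_of_affine_in_second _ (near0 d) (b2 / D) (- b1 / D) r1
             (- a2 / D) (a1 / D) r2 (fun z => / E z) (fun z => - (z ^ 2 * O z * / E z)));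
             auto 6 with smooth.
           intros u' v' H'. fold (l1 u' v') (l2 u' v'). unfold Rdiv. ring.
      * unfold Psi, Phi. cbn [fst snd].
        assert (Q := Enz _ Hz).
        replace ((l2 u v - l1 u v ^ 2 * O (l1 u v)) / E (l1 u v) * E (l1 u v)
          + l1 u v ^ 2 * O (l1 u v)) with (l2 u v) by (field; exact Q).
        now rewrite L3, L4.
    + assert (K : locally ((0, 0) : R * R) (fun w : R * R => near0 d (1 * fst w + 0 * snd w + 0))).
      { apply (locally_2d_locally (fun u v => near0 d (1 * u + 0 * v + 0))).
        apply locally_2d_preimage; [apply open_near0 | apply continuity_2d_pt_affine | near]. }
      revert K. apply filter_imp. intros [u v] Hw. simpl in Hw.
      assert (Hu : near0 d u) by near. split.
      * intros n. simpl. split.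
        -- apply (ex_diff_n_of_affine_in_second _ (near0 d) 1 0 0 0 1 0
             (fun z => b1 * E z) (fun z => c1 + z * a1 + z ^ 2 * O z * b1)); auto 8 with smooth.
           intros u' v' _. replace (1 * u' + 0 * v' + 0) with u' by ring. ring.
        -- apply (ex_diff_n_of_affine_in_second _ (near0 d) 1 0 0 0 1 0
             (fun z => b2 * E z) (fun z => c2 + z * a2 + z ^ 2 * O z * b2)); auto 8 with smooth.
           intros u' v' _. replace (1 * u' + 0 * v' + 0) with u' by ring. ring.
      * unfold Psi, Phi. cbn [fst snd]. rewrite L1, L2.
        apply (f_equal2 pair); [reflexivity|].
        field. now apply Enz.
  - apply near0_locally with d; [exact Hd|]. intros s Hs.
    destruct (Hmain s Hs) as (_ & Q1 & Q2 & Q3 & Q4).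
    unfold Phi. change (fst (C (t0 + phi s))) with (f (t0 + phi s)).
    change (snd (C (t0 + phi s))) with (g (t0 + phi s)).
    change (l1 (f (t0 + phi s)) (g (t0 + phi s))) with (x (phi s)).
    change (l2 (f (t0 + phi s)) (g (t0 + phi s))) with (y (phi s)).
    rewrite (EX _ Q1), (EY _ Q1), Q3, Q4.
    apply (f_equal2 pair); [reflexivity|]. field. now apply Enz.
Qed.

(** * Parity of the number of simple zeros over a period *)

(** The supremum of the x in [a, b] with Q a x is b: otherwise the local property at the
    supremum would extend Q beyond it. *)
Lemma interval_induction (Q : R -> R -> Prop) :
  (forall x, exists e, 0 < e /\ forall a b, x - e < a -> a <= b -> b < x + e -> Q a b) ->
  (forall a m b, a <= m -> m <= b -> Q a m -> Q m b -> Q a b) ->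
  forall a b, a <= b -> Q a b.
Proof.
  intros Hloc Hadd a b Hab.
  set (E x := a <= x <= b /\ Q a x).
  destruct (completeness E) as (c & Hub & Hlub).
  - exists b. intros x [Hx _]. lra.
  - exists a. split; [lra|]. destruct (Hloc a) as (e & He & H). apply H; lra.
  - destruct (Hloc c) as (e & He & H).
    assert (Hx : exists x, E x /\ c - e < x).
    { apply NNPP. intros Hn. assert (c <= c - e); [|lra].
      apply Hlub. intros x Hx. apply Rnot_lt_le. intros Hlt. apply Hn. now exists x. }
    destruct Hx as (x & [Hx HQ] & Hcx).
    assert (Hxc : x <= c) by (apply Hub; now split).
    assert (Hm1 : Rmin b (c + e / 2) <= b) by apply Rmin_l.
    assert (Hm2 : Rmin b (c + e / 2) <= c + e / 2) by apply Rmin_r.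
    assert (Hm3 : x <= Rmin b (c + e / 2)) by (apply Rmin_glb; lra).
    assert (HE : E (Rmin b (c + e / 2))).
    { split; [lra|]. apply Hadd with x; [lra | exact Hm3 | exact HQ | apply H; lra]. }
    assert (K := Hub _ HE).
    replace b with (Rmin b (c + e / 2)); [apply HE|].
    unfold Rmin in *. destruct (Rle_dec b (c + e / 2)); lra.
Qed.

Lemma simple_zero_sign (h : R -> R) x l : is_derive h x l -> h x = 0 -> l <> 0 ->
  exists e, 0 < e /\ forall y, x - e < y < x + e -> y <> x -> 0 < h y * l * (y - x).
Proof.
  intros Hd H0 Hl. apply is_derive_Reals in Hd.
  destruct (Hd (Rabs l) (Rabs_pos_lt _ Hl)) as [e He].
  exists e. split; [apply cond_pos|]. intros y Hy Hne.
  specialize (He (y - x) ltac:(lra) ltac:(apply Rabs_def1; lra)).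
  replace (x + (y - x)) with y in He by ring. rewrite H0, Rminus_0_r in He.
  set (q := h y / (y - x)) in *.
  assert (Eq : h y = q * (y - x)) by (unfold q; field; lra).
  assert (Hql : 0 < q * l).
  { destruct (Rle_dec 0 l) as [Hp|Hn].
    - rewrite (Rabs_pos_eq l) in He by lra. apply Rabs_def2 in He. nra.
    - rewrite (Rabs_left l) in He by lra. apply Rabs_def2 in He. nra. }
  rewrite Eq. replace (q * (y - x) * l * (y - x)) with ((q * l) * (y - x)²) by (unfold Rsqr; ring).
  apply Rmult_lt_0_compat; [exact Hql|]. apply Rlt_0_sqr. lra.
Qed.

(** The sign of h immediately to the left of x, h having only simple zeros. *)
Definition left_sign (h h' : R -> R) (x : R) : bool :=
  if Req_EM_T (h x) 0 then (if Rlt_dec (h' x) 0 then true else false)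
  else (if Rlt_dec 0 (h x) then true else false).

(** Half-open intervals and signs to the left fit together: a zero at a common end
    point of two intervals is counted once, and the relation is additive in the interval. *)
Definition zeros_match_signs (h h' : R -> R) (a b : R) : Prop :=
  exists l : list R, NoDup l /\ (forall t, In t l <-> a <= t < b /\ h t = 0) /\
    Nat.even (length l) = eqb (left_sign h h' a) (left_sign h h' b).

Lemma zeros_match_signs_add h h' a m b : a <= m -> m <= b ->
  zeros_match_signs h h' a m -> zeros_match_signs h h' m b -> zeros_match_signs h h' a b.
Proof.
  intros Ham Hmb (l1 & N1 & I1 & E1) (l2 & N2 & I2 & E2). exists (l1 ++ l2). split; [|split].
  - apply NoDup_app; auto. intros t Ht1 Ht2. apply I1 in Ht1. apply I2 in Ht2. lra.
  - intros t. rewrite in_app_iff, I1, I2. destruct (Rlt_dec t m); intuition lra.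
  - rewrite length_app, Nat.even_add, E1, E2.
    destruct (left_sign h h' a), (left_sign h h' m), (left_sign h h' b); reflexivity.
Qed.

Lemma zeros_match_signs_local h h' : (forall t, is_derive h t (h' t)) ->
  (forall t, h t = 0 -> h' t <> 0) ->
  forall x, exists e, 0 < e /\ forall a b, x - e < a -> a <= b -> b < x + e ->
    zeros_match_signs h h' a b.
Proof.
  intros Hd Hs x. destruct (Req_dec (h x) 0) as [H0|H0].
  - destruct (simple_zero_sign h x (h' x) (Hd x) H0 (Hs x H0)) as (e & He & H).
    assert (Hl := Hs x H0).
    assert (S1 : forall y, x - e < y <= x -> left_sign h h' y = if Rlt_dec (h' x) 0 then true else false).
    { intros y Hy. unfold left_sign. destruct (Req_dec y x) as [->|Hne].
      - destruct (Req_EM_T (h x) 0); [reflexivity | contradiction].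
      - assert (K := H y ltac:(lra) Hne).
        destruct (Req_EM_T (h y) 0) as [Z|Z]; [rewrite Z in K; lra|].
        destruct (Rlt_dec 0 (h y)), (Rlt_dec (h' x) 0); try reflexivity; exfalso.
        + assert (0 <= h y * h' x) by (apply Rmult_le_pos; lra). nra.
        + assert (0 <= (- h y) * (- h' x)) by (apply Rmult_le_pos; lra). nra. }
    assert (S2 : forall y, x < y < x + e -> left_sign h h' y = if Rlt_dec (h' x) 0 then false else true).
    { intros y Hy. unfold left_sign. assert (K := H y ltac:(lra) ltac:(lra)).
      destruct (Req_EM_T (h y) 0) as [Z|Z]; [rewrite Z in K; lra|].
      destruct (Rlt_dec 0 (h y)), (Rlt_dec (h' x) 0); try reflexivity; exfalso.
      + assert (0 <= h y * (- h' x)) by (apply Rmult_le_pos; lra). nra.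
      + assert (0 <= (- h y) * h' x) by (apply Rmult_le_pos; lra). nra. }
    assert (U : forall y, x - e < y < x + e -> h y = 0 -> y = x).
    { intros y Hy Z. apply NNPP. intros Hne. assert (K := H y Hy Hne). rewrite Z in K. lra. }
    exists e. split; [exact He|]. intros a b Ha Hab Hb.
    destruct (Rle_dec a x) as [Hax|Hax]; [destruct (Rlt_dec x b) as [Hxb|Hxb]|].
    + exists (x :: nil). split; [|split].
      * constructor; [intros []| constructor].
      * intros t. simpl. split.
        -- intros [<-|[]]. auto.
        -- intros [Ht Z]. left. symmetry. apply U; [lra | exact Z].
      * rewrite S1, S2 by lra. now destruct (Rlt_dec (h' x) 0).
    + exists nil. split; [constructor|]. split.
      * intros t. simpl. split; [intros []|]. intros [Ht Z]. assert (t = x) by (apply U; [lra|exact Z]). lra.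
      * rewrite !S1 by lra. now destruct (Rlt_dec (h' x) 0).
    + exists nil. split; [constructor|]. split.
      * intros t. simpl. split; [intros []|]. intros [Ht Z]. assert (t = x) by (apply U; [lra|exact Z]). lra.
      * rewrite !S2 by lra. now destruct (Rlt_dec (h' x) 0).
  - assert (HL : locally x (fun y => 0 < h y * h x)).
    { assert (Hc : continuous (fun y => h y * h x) x).
      { apply (continuous_mult h (fun _ => h x)); [|apply continuous_const].
        apply (ex_derive_continuous (V := R_NormedModule)). exists (h' x). apply Hd. }
      apply (Hc (fun w => 0 < w)). apply (open_gt 0). nra. }
    apply locally_R in HL. destruct HL as (e & He & H).
    exists e. split; [exact He|]. intros a b Ha Hab Hb. exists nil. split; [constructor|]. split.
    + intros t. simpl. split; [intros []|]. intros [Ht Z].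
      assert (K := H t ltac:(lra)). rewrite Z in K. lra.
    + assert (S : forall y, x - e < y < x + e ->
        left_sign h h' y = if Rlt_dec 0 (h x) then true else false).
      { intros y Hy. assert (K := H y Hy). unfold left_sign.
        destruct (Req_EM_T (h y) 0) as [Z|Z]; [rewrite Z in K; lra|].
        destruct (Rlt_dec 0 (h y)), (Rlt_dec 0 (h x)); try reflexivity; exfalso; nra. }
      rewrite !S by lra. now destruct (Rlt_dec 0 (h x)).
Qed.

Lemma even_number_of_simple_zeros h h' a b : a <= b ->
  (forall t, is_derive h t (h' t)) -> (forall t, h t = 0 -> h' t <> 0) ->
  h a = h b -> h' a = h' b ->
  exists l : list R, NoDup l /\ (forall t, In t l <-> a <= t < b /\ h t = 0) /\
    Nat.Even (length l).
Proof.
  intros Hab Hd Hs E E'.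
  destruct (interval_induction (zeros_match_signs h h') (zeros_match_signs_local h h' Hd Hs)
    (zeros_match_signs_add h h') a b Hab) as (l & N & I & P).
  exists l. split; [exact N|]. split; [exact I|]. apply Nat.even_spec. rewrite P.
  unfold left_sign. rewrite E, E'. apply eqb_reflx.
Qed.

(** * Angles *)

Lemma circle_pt_eq s t : circle_pt s = circle_pt t -> exists k : Z, s = t + 2 * IZR k * PI.
Proof.
  unfold circle_pt. intros H. injection H as Hc Hs.
  assert (E : cos (s - t) = 1).
  { rewrite cos_minus, Hc, Hs. generalize (sin2_cos2 t). unfold Rsqr. lra. }
  assert (Z : sin ((s - t) / 2) = 0).
  { replace (s - t) with (2 * ((s - t) / 2)) in E by field. rewrite cos_2a_sin in E.
    apply Rsqr_0_uniq. unfold Rsqr. lra. }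
  apply sin_eq_0_0 in Z. destruct Z as [k Hk]. exists k. lra.
Qed.

Lemma circle_pt_shift t k : circle_pt (t + 2 * IZR k * PI) = circle_pt t.
Proof.
  unfold circle_pt.
  assert (P : forall u (n : nat), cos (u + 2 * INR n * PI) = cos u /\ sin (u + 2 * INR n * PI) = sin u)
    by (intros; split; [apply cos_period | apply sin_period]).
  destruct (Z_le_gt_dec 0 k) as [H|H].
  - replace (IZR k) with (INR (Z.to_nat k)) by (rewrite INR_IZR_INZ, Z2Nat.id by lia; reflexivity).
    destruct (P t (Z.to_nat k)) as [-> ->]. reflexivity.
  - destruct (P (t + 2 * IZR k * PI) (Z.to_nat (- k))) as [E1 E2].
    replace (t + 2 * IZR k * PI + 2 * INR (Z.to_nat (- k)) * PI) with t in E1, E2.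
    + now rewrite E1, E2.
    + rewrite INR_IZR_INZ, Z2Nat.id by lia. rewrite opp_IZR. ring.
Qed.

Lemma periodic_shift {T : Type} (g : R -> T) : (forall t, g (t + 2 * PI) = g t) ->
  forall (k : Z) t, g (t + 2 * IZR k * PI) = g t.
Proof.
  intros Hg.
  assert (N : forall (n : nat) t, g (t + 2 * INR n * PI) = g t).
  { induction n as [|n IH]; intros t.
    - f_equal. simpl. ring.
    - rewrite S_INR. replace (t + 2 * (INR n + 1) * PI) with ((t + 2 * INR n * PI) + 2 * PI) by ring.
      rewrite Hg. apply IH. }
  intros k t. destruct (Z_le_gt_dec 0 k) as [H|H].
  - replace (IZR k) with (INR (Z.to_nat k)) by (rewrite INR_IZR_INZ, Z2Nat.id by lia; reflexivity).
    apply N.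
  - rewrite <- (N (Z.to_nat (- k))). f_equal. rewrite INR_IZR_INZ, Z2Nat.id by lia.
    rewrite opp_IZR. ring.
Qed.

Lemma periodic_circle {T : Type} (g : R -> T) : (forall t, g (t + 2 * PI) = g t) ->
  forall s t, circle_pt s = circle_pt t -> g s = g t.
Proof.
  intros Hg s t H. apply circle_pt_eq in H. destruct H as [k ->]. now apply periodic_shift.
Qed.

Lemma Derive_shift (g : R -> R) c t : Derive (fun u => g (u + c)) t = Derive g (t + c).
Proof. exact (Derive_n_comp_trans g 1 t c). Qed.

Lemma Derive_periodic g : (forall t, g (t + 2 * PI) = g t) ->
  forall t, Derive g (t + 2 * PI) = Derive g t.
Proof. intros Hg t. rewrite <- Derive_shift. now apply Derive_ext. Qed.

Lemma circle_pt_near a e : 0 < e -> exists d, 0 < d /\ forall s,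
  Rabs (cos s - cos a) < d -> Rabs (sin s - sin a) < d ->
  exists k : Z, Rabs (s + 2 * IZR k * PI - a) < e.
Proof.
  intros He. assert (HPI := PI_RGT_0). set (e1 := Rmin e PI).
  assert (He1 : 0 < e1 <= PI) by (split; [now apply Rmin_glb_lt | apply Rmin_r]).
  assert (He2 : e1 <= e) by apply Rmin_l.
  assert (Hcos : 0 < 1 - cos e1).
  { assert (cos e1 < cos 0) by (apply cos_decreasing_1; lra). rewrite cos_0 in *. lra. }
  exists (Rmin 1 (1 - cos e1)). split; [apply Rmin_glb_lt; lra|]. intros s Hc Hs.
  assert (M1 : Rmin 1 (1 - cos e1) <= 1) by apply Rmin_l.
  assert (M2 : Rmin 1 (1 - cos e1) <= 1 - cos e1) by apply Rmin_r.
  (* This multiple of 2 PI brings s - a into the interval from - PI to PI. *)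
  set (r := - (s - a) / (2 * PI) - / 2). exists (up r).
  destruct (archimed r) as [A1 A2]. set (k := IZR (up r)) in *.
  set (c := s + 2 * k * PI - a).
  assert (Er : - (s - a) = (r + / 2) * (2 * PI)) by (unfold r; field; lra).
  assert (Hd1 : - PI < c) by (unfold c; nra). assert (Hd2 : c <= PI) by (unfold c; nra).
  assert (Ec : cos c = cos s * cos a + sin s * sin a).
  { transitivity (cos (s - a)); [|apply cos_minus].
    unfold c. replace (s + 2 * k * PI - a) with ((s - a) + 2 * k * PI) by ring.
    exact (f_equal fst (circle_pt_shift (s - a) (up r))). }
  (* 2 (1 - cos c) is the squared distance of the two points of the circle. *)
  assert (Hlt : 1 - cos c < 1 - cos e1).
  { assert (S1 := sin2_cos2 s). assert (S2 := sin2_cos2 a). unfold Rsqr in *.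
    apply Rabs_def2 in Hc. apply Rabs_def2 in Hs.
    set (p := cos s - cos a) in *. set (q := sin s - sin a) in *.
    assert (Q : 2 * (1 - cos c) = p * p + q * q) by (rewrite Ec; unfold p, q; nra).
    set (d := Rmin 1 (1 - cos e1)) in *.
    assert (p * p < d) by nra. assert (q * q < d) by nra. lra. }
  apply Rlt_le_trans with e1; [|exact He2].
  apply Rnot_le_lt. intros Hge.
  assert (Hce : cos c <= cos e1).
  { unfold Rabs in Hge. destruct (Rcase_abs c).
    - rewrite <- (cos_neg c). apply cos_decr_1; lra.
    - apply cos_decr_1; lra. }
  lra.
Qed.

(** * The curve and its parallel pairs *)

Definition xc (f : R -> plane) (u : R) : R := fst (f u).
Definition yc (f : R -> plane) (u : R) : R := snd (f u).

(** [tangent_det f s t] vanishes when the tangents at s and t are parallel;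
    [curvature_det f] is the numerator of the curvature. *)
Definition tangent_det (f : R -> plane) (s t : R) : R :=
  Derive (xc f) s * Derive (yc f) t - Derive (yc f) s * Derive (xc f) t.
Definition curvature_det (f : R -> plane) (s : R) : R :=
  Derive (xc f) s * Derive (Derive (yc f)) s - Derive (yc f) s * Derive (Derive (xc f)) s.
Definition speed2 (f : R -> plane) (s : R) : R := Derive (xc f) s ^ 2 + Derive (yc f) s ^ 2.
Definition speed (f : R -> plane) (s : R) : R := sqrt (speed2 f s).

Lemma deriv1_eq f s : deriv 1 f s = (Derive (xc f) s, Derive (yc f) s).
Proof. reflexivity. Qed.

Lemma tangent_det_eq f s t : det2 (deriv 1 f s) (deriv 1 f t) = tangent_det f s t.
Proof. reflexivity. Qed.

Lemma curvature_eq f s : curvature f s = curvature_det f s / speed f s ^ 3.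
Proof. reflexivity. Qed.

Section RegularCurve.

Variable f : R -> plane.
Hypothesis Hreg : closed_regular_curve f.

Lemma xc_smooth : smooth_on everywhere (xc f).
Proof. intros t _. apply Hreg. Qed.

Lemma yc_smooth : smooth_on everywhere (yc f).
Proof. intros t _. apply Hreg. Qed.

Hint Resolve xc_smooth yc_smooth : smooth.

Lemma speed2_pos s : 0 < speed2 f s.
Proof.
  destruct Hreg as (_ & _ & H). specialize (H s). rewrite deriv1_eq in H. unfold speed2.
  destruct (Req_dec (Derive (xc f) s) 0) as [E1|E1].
  - destruct (Req_dec (Derive (yc f) s) 0) as [E2|E2]; [now rewrite E1, E2 in H|].
    rewrite E1. assert (0 < Derive (yc f) s ^ 2) by (apply pow2_gt_0; exact E2). lra.
  - assert (0 < Derive (xc f) s ^ 2) by (apply pow2_gt_0; exact E1).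
    assert (0 <= Derive (yc f) s ^ 2) by apply pow2_ge_0. lra.
Qed.

Lemma speed_pos s : 0 < speed f s.
Proof. apply sqrt_lt_R0, speed2_pos. Qed.

Lemma speed_sqr s : speed f s ^ 2 = speed2 f s.
Proof. unfold speed. rewrite pow2_sqrt; [reflexivity|]. apply Rlt_le, speed2_pos. Qed.

Lemma speed2_smooth : smooth_on everywhere (speed2 f).
Proof. unfold speed2. auto with smooth. Qed.

Lemma speed_smooth : smooth_on everywhere (speed f).
Proof.
  apply smooth_on_sqrt; auto using speed2_smooth with smooth. intros t _. apply speed2_pos.
Qed.

Lemma curvature_det_smooth : smooth_on everywhere (curvature_det f).
Proof. unfold curvature_det. auto 6 with smooth. Qed.

Lemma curvature_smooth : smooth_on everywhere (curvature f).
Proof.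
  apply (smooth_on_div everywhere (curvature_det f) (fun s => speed f s ^ 3));
    auto using curvature_det_smooth, speed_smooth with smooth.
  intros t _. assert (K := speed_pos t). apply pow_nonzero. lra.
Qed.

Lemma curvature_zero s : curvature f s = 0 <-> curvature_det f s = 0.
Proof.
  rewrite curvature_eq. assert (K := pow_lt _ 3 (speed_pos s)). split; intros H.
  - replace (curvature_det f s) with (curvature_det f s / speed f s ^ 3 * speed f s ^ 3)
      by (field; assert (Q := speed_pos s); lra).
    rewrite H. ring.
  - rewrite H. unfold Rdiv. ring.
Qed.

Lemma deriv1_periodic s t : circle_pt s = circle_pt t ->
  Derive (xc f) s = Derive (xc f) t /\ Derive (yc f) s = Derive (yc f) t.
Proof.
  destruct Hreg as (_ & Hp & _). intros H.
  split; apply (periodic_circle (Derive _)); try exact H; apply Derive_periodic;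
    intros u; unfold xc, yc; now rewrite Hp.
Qed.

Lemma tangent_det_continuity s t : continuity_2d_pt (tangent_det f) s t.
Proof.
  assert (C : forall g x, smooth_on everywhere g -> continuity_pt (Derive g) x).
  { intros g x Hg. apply continuity_pt_filterlim.
    apply smooth_on_continuous with everywhere; [auto with smooth | exact I]. }
  unfold tangent_det. apply continuity_2d_pt_minus; apply continuity_2d_pt_mult.
  - apply (continuity_1d_2d_pt_comp (Derive (xc f)) (fun u _ => u));
      auto using continuity_2d_pt_id1, xc_smooth.
  - apply (continuity_1d_2d_pt_comp (Derive (yc f)) (fun _ v => v));
      auto using continuity_2d_pt_id2, yc_smooth.
  - apply (continuity_1d_2d_pt_comp (Derive (yc f)) (fun u _ => u));
      auto using continuity_2d_pt_id1, yc_smooth.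
  - apply (continuity_1d_2d_pt_comp (Derive (xc f)) (fun _ v => v));
      auto using continuity_2d_pt_id2, xc_smooth.
Qed.

(** Nearby points of the torus have lifts near (a, b), and f' does not depend on the lift. *)
Lemma Sigma_near a b e : Sigma f (torus_pt (a, b)) -> 0 < e ->
  exists s t, Rabs (s - a) < e /\ Rabs (t - b) < e /\
    circle_pt s <> circle_pt t /\ tangent_det f s t = 0.
Proof.
  intros HS He.
  destruct (circle_pt_near a e He) as (d1 & Hd1 & H1).
  destruct (circle_pt_near b e He) as (d2 & Hd2 & H2).
  set (d := Rmin d1 d2). assert (Hd : 0 < d) by now apply Rmin_glb_lt.
  destruct (HS (fun q => ball (torus_pt (a, b)) d q)) as (q & Hq & s & t & -> & Hne & Hdet).
  { exists (mkposreal d Hd). auto. }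
  assert (L1 : d <= d1) by apply Rmin_l. assert (L2 : d <= d2) by apply Rmin_r.
  destruct Hq as [[Q1 Q2] [Q3 Q4]].
  destruct (H1 s) as [k Hk]; [exact (Rlt_le_trans _ _ _ Q1 L1) | exact (Rlt_le_trans _ _ _ Q2 L1)|].
  destruct (H2 t) as [m Hm]; [exact (Rlt_le_trans _ _ _ Q3 L2) | exact (Rlt_le_trans _ _ _ Q4 L2)|].
  exists (s + 2 * IZR k * PI), (t + 2 * IZR m * PI). split; [exact Hk|]. split; [exact Hm|].
  rewrite !circle_pt_shift. split; [exact Hne|].
  rewrite <- Hdet, tangent_det_eq. unfold tangent_det.
  destruct (deriv1_periodic _ _ (circle_pt_shift s k)) as [-> ->].
  destruct (deriv1_periodic _ _ (circle_pt_shift t m)) as [-> ->]. reflexivity.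
Qed.

Lemma Sigma_parallel a b : Sigma f (torus_pt (a, b)) -> tangent_det f a b = 0.
Proof.
  intros HS. apply NNPP. intros Hne.
  destruct (continuity_2d_pt_neq_0 _ _ _ (tangent_det_continuity a b) Hne) as [d Hd].
  destruct (Sigma_near a b d HS (cond_pos d)) as (s & t & Hs & Ht & _ & E).
  exact (Hd s t Hs Ht E).
Qed.

(** Near a0 the slope of the tangent relative to the direction f'(a0) is a
    well-defined function. It takes equal values at parallel tangents, and its derivative is the
    curvature up to a positive factor. *)
Lemma parallel_tangents_enclose_zero_curvature a0 : exists r, 0 < r /\
  forall s t, a0 - r < s -> s < t -> t < a0 + r -> tangent_det f s t = 0 ->
    exists xi, s < xi < t /\ curvature_det f xi = 0.
Proof.
  set (v := Derive (xc f) a0). set (w := Derive (yc f) a0).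
  set (p := fun s => v * Derive (xc f) s + w * Derive (yc f) s).
  set (q := fun s => v * Derive (yc f) s - w * Derive (xc f) s).
  assert (Hvw : 0 < v ^ 2 + w ^ 2) by exact (speed2_pos a0).
  assert (Hp : smooth_on everywhere p) by (unfold p; auto 8 with smooth).
  assert (HL : locally a0 (fun s => 0 < p s)).
  { apply (smooth_on_continuous everywhere p a0 Hp I (fun z => 0 < z)).
    apply (open_gt 0). unfold p. fold v w. nra. }
  apply locally_R in HL. destruct HL as (r & Hr & HL). exists r. split; [exact Hr|].
  intros s t Hs Hst Ht Hdet.
  assert (Ex : forall u, ex_derive (Derive (xc f)) u).
  { intros u. apply smooth_on_ex_derive with everywhere; [auto with smooth | exact I]. }
  assert (Ey : forall u, ex_derive (Derive (yc f)) u).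
  { intros u. apply smooth_on_ex_derive with everywhere; [auto with smooth | exact I]. }
  destruct (MVT_cor2 (fun u => q u / p u)
    (fun u => (v ^ 2 + w ^ 2) * curvature_det f u / p u ^ 2) s t Hst) as (xi & E & Hxi).
  { intros c Hc. assert (Pc := HL c ltac:(lra)). apply is_derive_Reals.
    replace ((v ^ 2 + w ^ 2) * curvature_det f c / p c ^ 2) with
      (((v * Derive (Derive (yc f)) c - w * Derive (Derive (xc f)) c) * p c
        - q c * (v * Derive (Derive (xc f)) c + w * Derive (Derive (yc f)) c)) / p c ^ 2).
    - apply is_derive_div; [| |lra].
      + apply (is_derive_minus (V := R_NormedModule)
          (fun s => v * Derive (yc f) s) (fun s => w * Derive (xc f) s));
          [apply (is_derive_scal (Derive (yc f))) | apply (is_derive_scal (Derive (xc f)))];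
          now apply Derive_correct.
      + apply (is_derive_plus (V := R_NormedModule)
          (fun s => v * Derive (xc f) s) (fun s => w * Derive (yc f) s));
          [apply (is_derive_scal (Derive (xc f))) | apply (is_derive_scal (Derive (yc f)))];
          now apply Derive_correct.
    - f_equal. unfold p, q, curvature_det. ring. }
  exists xi. split; [lra|].
  assert (Ps := HL s ltac:(lra)). assert (Pt := HL t ltac:(lra)). assert (Px := HL xi ltac:(lra)).
  assert (Eq : q t / p t - q s / p s = 0).
  { replace (q t / p t - q s / p s) with ((q t * p s - q s * p t) / (p t * p s)) by (field; lra).
    replace (q t * p s - q s * p t) with ((v ^ 2 + w ^ 2) * tangent_det f s t)
      by (unfold p, q, tangent_det; ring).
    rewrite Hdet. unfold Rdiv. ring. }
  rewrite Eq in E. symmetry in E. apply Rmult_integral in E. destruct E as [E|E]; [|lra].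
  apply (f_equal (fun z => z * p xi ^ 2 / (v ^ 2 + w ^ 2))) in E.
  replace (0 * p xi ^ 2 / (v ^ 2 + w ^ 2)) with 0 in E by (field; lra).
  rewrite <- E. field. lra.
Qed.

(** Rolle's theorem, applied to the pairs s <> t that converge to the diagonal point. *)
Lemma diagonal_zero_curvature a b : Sigma f (torus_pt (a, b)) -> circle_pt a = circle_pt b ->
  curvature_det f a = 0.
Proof.
  intros HS Hab. apply circle_pt_eq in Hab. destruct Hab as [k Hk].
  destruct (parallel_tangents_enclose_zero_curvature a) as (r & Hr & H).
  apply NNPP. intros Hne.
  assert (HL : locally a (fun x => curvature_det f x <> 0)).
  { apply (smooth_on_continuous everywhere _ a curvature_det_smooth I (fun z => z <> 0)).
    now apply (open_neq 0). }
  apply locally_R in HL. destruct HL as (d & Hd & HL).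
  assert (Hm1 : Rmin r d <= r) by apply Rmin_l. assert (Hm2 : Rmin r d <= d) by apply Rmin_r.
  destruct (Sigma_near a b (Rmin r d) HS) as (s & t & Hs & Ht & Hne' & E);
    [now apply Rmin_glb_lt|].
  set (t' := t + 2 * IZR k * PI).
  assert (Et : tangent_det f s t' = 0).
  { rewrite <- E. unfold tangent_det, t'.
    destruct (deriv1_periodic _ _ (circle_pt_shift t k)) as [-> ->]. reflexivity. }
  apply Rabs_def2 in Hs. apply Rabs_def2 in Ht.
  assert (Hne2 : s <> t').
  { intros Est. apply Hne'. rewrite Est. apply circle_pt_shift. }
  assert (Ht' : a - Rmin r d < t' < a + Rmin r d) by (unfold t'; lra).
  destruct (Rdichotomy _ _ Hne2) as [Hlt|Hlt].
  - destruct (H s t') as (xi & Hxi & Z); [lra | lra | lra | exact Et |].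
    apply (HL xi); [lra | exact Z].
  - destruct (H t' s) as (xi & Hxi & Z); [lra | lra | lra | |].
    + rewrite <- Ropp_0, <- Et. unfold tangent_det. ring.
    + apply (HL xi); [lra | exact Z].
Qed.

End RegularCurve.

(** ** Arc length *)

Lemma primitive_exists g : smooth_on everywhere g -> exists G,
  smooth_on everywhere G /\ forall t, is_derive G t (g t).
Proof.
  intros Hg.
  assert (Hd : forall t, is_derive (fun t => RInt g 0 t) t (g t)).
  { intros t. apply (is_derive_RInt (V := R_NormedModule) g _ 0 t).
    - apply filter_forall. intros u. apply (RInt_correct (V := R_CompleteNormedModule) g).
      apply (ex_RInt_continuous (V := R_CompleteNormedModule)). intros z _.
      now apply (smooth_on_continuous everywhere).
    - now apply (smooth_on_continuous everywhere). }
  exists (fun t => RInt g 0 t). split; [|exact Hd].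
  apply smooth_on_intro with g; auto with smooth.
Qed.

Lemma is_derive_compose (g h : R -> R) u l m : is_derive g (h u) l -> is_derive h u m ->
  is_derive (fun u => g (h u)) u (m * l).
Proof. intros Hg Hh. apply (is_derive_comp (V := R_NormedModule) g h u l m); assumption. Qed.

Lemma is_derive_product (g h : R -> R) u l m : is_derive g u l -> is_derive h u m ->
  is_derive (fun u => g u * h u) u (l * h u + g u * m).
Proof. intros Hg Hh. apply (is_derive_mult g h u l m); [assumption | assumption | exact Rmult_comm]. Qed.

(** The inverse of the function sg * (arc length from s0) gives the parameterization
    by arc length in the direction sg; reversing the direction changes the sign of the
    curvature, and changes it once more in its derivative. *)
Lemma arc_length_param_exists f s0 sg : closed_regular_curve f -> sg = 1 \/ sg = -1 ->
  exists p, local_arc_length_param f s0 p /\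
    deriv 1 p 0 = (sg / speed f s0 * Derive (xc f) s0, sg / speed f s0 * Derive (yc f) s0) /\
    curvature p 0 = sg * curvature f s0 /\
    Derive (curvature p) 0 = Derive (curvature f) s0 / speed f s0.
Proof.
  intros Hreg Hsg.
  assert (Hsg2 : sg * sg = 1) by (destruct Hsg; subst; ring).
  assert (Hsp := speed_smooth f Hreg). assert (Hpos := speed_pos f Hreg).
  assert (Hx := xc_smooth f Hreg). assert (Hy := yc_smooth f Hreg).
  destruct (primitive_exists (fun t => sg * speed f t)) as (G & HG & DG); auto with smooth.
  set (L := fun t => G t - G s0).
  assert (HL : smooth_on everywhere L) by (unfold L; auto with smooth).
  assert (DL : forall t, is_derive L t (sg * speed f t)).
  { intros t. unfold L. replace (sg * speed f t) with (minus (sg * speed f t) zero)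
      by (unfold minus, plus, opp, zero; simpl; ring).
    apply (is_derive_minus (V := R_NormedModule) G (fun _ => G s0)); [apply DG|].
    apply (is_derive_const (V := R_NormedModule)). }
  assert (L0 : L s0 = 0) by (unfold L; ring).
  destruct (inverse_function everywhere L s0) as (h & d & e & Hd & He & Hh & Hv & Hu);
    auto with smooth; [exact I | |].
  { rewrite (is_derive_unique _ _ _ (DL s0)). specialize (Hpos s0). nra. }
  rewrite L0 in Hh, Hv.
  assert (h0 : h 0 = s0) by (rewrite <- L0; apply Hu; lra).
  assert (Hh' : smooth_on (near0 d) h).
  { apply smooth_on_sub with (2 := Hh). unfold near0. intros; lra. }
  assert (Lh : forall u, near0 d u -> L (h u) = u).
  { intros u Hu'. apply Hv. unfold near0 in Hu'. lra. }
  set (w := fun u => sg / speed f (h u)).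
  assert (Hw : smooth_on (near0 d) w).
  { unfold w. apply smooth_on_div; auto with smooth.
    - intros t _. specialize (Hpos (h t)). lra.
    - apply smooth_on_comp with everywhere; auto with smooth. intros; exact I. }
  assert (Dh : forall u, near0 d u -> is_derive h u (w u)).
  { intros u Hu'. replace (w u) with (Derive h u);
      [apply Derive_correct; now apply smooth_on_ex_derive with (near0 d)|].
    assert (E1 : is_derive (fun u => L (h u)) u (Derive h u * (sg * speed f (h u)))).
    { apply is_derive_compose; [apply DL|].
      apply Derive_correct. now apply smooth_on_ex_derive with (near0 d). }
    assert (E2 : is_derive (fun u => L (h u)) u 1).
    { apply is_derive_ext_loc with (fun u => u); [|exact (is_derive_id (K := R_AbsRing) u)].
      apply (filter_imp (near0 d)); [intros z Hz; symmetry; now apply Lh | now apply open_near0]. }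
    apply is_derive_unique in E1. apply is_derive_unique in E2. rewrite E2 in E1.
    unfold w. specialize (Hpos (h u)).
    replace (Derive h u) with (sg * sg * Derive h u) by (rewrite Hsg2; ring).
    apply Rmult_eq_reg_r with (speed f (h u)); [|lra].
    replace (sg / speed f (h u) * speed f (h u)) with (sg * 1) by (field; lra).
    rewrite E1. ring. }
  assert (Comp : forall g, smooth_on everywhere g -> forall u, near0 d u ->
    is_derive (fun u => g (h u)) u (w u * Derive g (h u))).
  { intros g Hg u Hu'. apply is_derive_compose; [|now apply Dh].
    apply Derive_correct. now apply smooth_on_ex_derive with everywhere. }
  assert (Comp2 : forall g, smooth_on everywhere g -> forall u, near0 d u ->
    Derive_n (fun u => g (h u)) 2 u
    = Derive w u * Derive g (h u) + w u * (w u * Derive (Derive g) (h u))).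
  { intros g Hg u Hu'. change (Derive_n (fun u => g (h u)) 2 u)
      with (Derive (Derive (fun u => g (h u))) u).
    rewrite (Derive_ext_loc _ (fun u => w u * Derive g (h u))).
    - apply is_derive_unique, (is_derive_product w (fun u => Derive g (h u))).
      + apply Derive_correct. now apply smooth_on_ex_derive with (near0 d).
      + apply (Comp (Derive g)); auto with smooth.
    - apply (filter_imp (near0 d)); [|now apply open_near0].
      intros z Hz. now apply is_derive_unique, Comp. }
  set (p := fun u => f (h u)).
  assert (D1 : forall u, near0 d u ->
    deriv 1 p u = (w u * Derive (xc f) (h u), w u * Derive (yc f) (h u))).
  { intros u Hu'. apply (f_equal2 pair).
    - exact (is_derive_unique _ _ _ (Comp _ Hx u Hu')).
    - exact (is_derive_unique _ _ _ (Comp _ Hy u Hu')). }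
  assert (Hw2 : forall u, w u ^ 2 * speed2 f (h u) = 1).
  { intros u. unfold w. rewrite <- (speed_sqr f Hreg). specialize (Hpos (h u)).
    transitivity (sg * sg); [field; lra | exact Hsg2]. }
  assert (N1 : forall u, near0 d u -> enorm (deriv 1 p u) = 1).
  { intros u Hu'. rewrite D1 by exact Hu'. unfold enorm. cbn [fst snd].
    rewrite <- sqrt_1 at 1. f_equal. rewrite <- (Hw2 u). unfold speed2. ring. }
  assert (K : forall u, near0 d u -> curvature p u = sg * curvature f (h u)).
  { intros u Hu'. unfold curvature at 1. rewrite N1, D1 by exact Hu'.
    assert (E2 : deriv 2 p u =
      (Derive w u * Derive (xc f) (h u) + w u * (w u * Derive (Derive (xc f)) (h u)),
       Derive w u * Derive (yc f) (h u) + w u * (w u * Derive (Derive (yc f)) (h u)))).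
    { apply (f_equal2 pair); [exact (Comp2 _ Hx u Hu') | exact (Comp2 _ Hy u Hu')]. }
    rewrite E2. unfold det2. cbn [fst snd].
    transitivity (w u ^ 3 * curvature_det f (h u)); [unfold curvature_det; field|].
    rewrite curvature_eq. unfold w. specialize (Hpos (h u)).
    transitivity (sg * (sg * sg) * curvature_det f (h u) / speed f (h u) ^ 3);
      [field; lra | rewrite Hsg2; field; lra]. }
  assert (Z : near0 d 0) by (unfold near0; lra).
  exists p. split; [|split; [|split]].
  - exists h. split; [exact h0|]. apply near0_locally with d; [exact Hd|].
    intros u Hu'. split; [now apply Hh'|]. split; [reflexivity | now apply N1].
  - rewrite D1 by exact Z. unfold w. now rewrite h0.
  - rewrite K by exact Z. now rewrite h0.
  - rewrite (Derive_ext_loc _ (fun u => sg * curvature f (h u)));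
      [|apply (filter_imp (near0 d)); [exact K | now apply open_near0]].
    assert (Kd := Comp _ (curvature_smooth f Hreg) 0 Z).
    apply (is_derive_scal _ _ sg), is_derive_unique in Kd. etransitivity; [exact Kd|].
    unfold w. rewrite h0. specialize (Hpos s0).
    transitivity (sg * sg * Derive (curvature f) s0 / speed f s0); [field; lra|].
    rewrite Hsg2. field. lra.
Qed.

(** * A branch of the secant caustic *)

Lemma is_derive_smooth_comp (g k : R -> R) u :
  smooth_on everywhere g -> smooth_on everywhere k ->
  is_derive (fun u => g (k u)) u (Derive k u * Derive g (k u)).
Proof.
  intros Hg Hk. apply is_derive_compose; apply Derive_correct;
    now apply smooth_on_ex_derive with everywhere.
Qed.

Lemma smooth_on_comp_everywhere (g k : R -> R) :
  smooth_on everywhere g -> smooth_on everywhere k -> smooth_on everywhere (fun u => g (k u)).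
Proof.
  intros Hg Hk. apply smooth_on_comp with everywhere; auto with smooth.
Qed.

Section Branch.

Variables (f : R -> plane) (a b : R -> R).
Hypothesis Hgen : generic f.
Hypothesis Ha : smooth_on everywhere a.
Hypothesis Hb : smooth_on everywhere b.
Hypothesis Himm : forall u, Derive a u = 0 -> Derive b u = 0 -> False.
Hypothesis HSigma : forall u, Sigma f (torus_pt (a u, b u)).

Let Hreg : closed_regular_curve f := generic_regular f Hgen.
Let Hx : smooth_on everywhere (xc f) := xc_smooth f Hreg.
Let Hy : smooth_on everywhere (yc f) := yc_smooth f Hreg.

Hint Resolve Ha Hb Hx Hy smooth_on_comp_everywhere : smooth.

(** The factor lambda with f'(a) = lambda f'(b). *)
Definition tangent_ratio (u : R) : R :=
  (Derive (xc f) (a u) * Derive (xc f) (b u) + Derive (yc f) (a u) * Derive (yc f) (b u))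
  / speed2 f (b u).

(** The factor h with (f(a) - f(b))' = h f'(b). *)
Definition caustic_speed (u : R) : R := Derive a u * tangent_ratio u - Derive b u.

Lemma branch_parallel u : tangent_det f (a u) (b u) = 0.
Proof. apply Sigma_parallel; auto. Qed.

Lemma tangent_ratio_spec u :
  Derive (xc f) (a u) = tangent_ratio u * Derive (xc f) (b u) /\
  Derive (yc f) (a u) = tangent_ratio u * Derive (yc f) (b u).
Proof.
  assert (P := speed2_pos f Hreg (b u)). assert (E := branch_parallel u).
  unfold tangent_det in E. unfold tangent_ratio.
  set (x1 := Derive (xc f) (a u)) in *. set (x2 := Derive (xc f) (b u)) in *.
  set (y1 := Derive (yc f) (a u)) in *. set (y2 := Derive (yc f) (b u)) in *.
  assert (S : speed2 f (b u) = x2 ^ 2 + y2 ^ 2) by reflexivity.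
  split; apply Rmult_eq_reg_r with (speed2 f (b u)); try lra.
  - transitivity ((x1 * x2 + y1 * y2) * x2); [rewrite S | field; lra].
    transitivity ((x1 * x2 + y1 * y2) * x2 + y2 * (x1 * y2 - y1 * x2)); [ring | rewrite E; ring].
  - transitivity ((x1 * x2 + y1 * y2) * y2); [rewrite S | field; lra].
    transitivity ((x1 * x2 + y1 * y2) * y2 - x2 * (x1 * y2 - y1 * x2)); [ring | rewrite E; ring].
Qed.

Lemma tangent_ratio_sqr u : speed2 f (a u) = tangent_ratio u ^ 2 * speed2 f (b u).
Proof. unfold speed2. destruct (tangent_ratio_spec u) as [-> ->]. ring. Qed.

Lemma tangent_ratio_nonzero u : tangent_ratio u <> 0.
Proof.
  intros E. assert (P := speed2_pos f Hreg (a u)). rewrite tangent_ratio_sqr, E in P. lra.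
Qed.

Lemma tangent_ratio_smooth : smooth_on everywhere tangent_ratio.
Proof.
  unfold tangent_ratio. apply smooth_on_div.
  - auto with smooth.
  - intros u _. assert (P := speed2_pos f Hreg (b u)). lra.
  - auto 10 with smooth.
  - apply smooth_on_comp_everywhere; auto using speed2_smooth.
Qed.

Lemma caustic_speed_smooth : smooth_on everywhere caustic_speed.
Proof. unfold caustic_speed. auto using tangent_ratio_smooth with smooth. Qed.

(** Both tangent lines turn at the same rate; this is the derivative of
    det (f'(a), f'(b)) = 0. *)
Lemma equal_turning u : Derive a u * curvature_det f (a u)
  = tangent_ratio u ^ 2 * Derive b u * curvature_det f (b u).
Proof.
  assert (D := fun g k Hg Hk => is_derive_smooth_comp (Derive g) k u (smooth_on_Derive _ _ Hg) Hk).
  assert (E := is_derive_minus (V := R_NormedModule) _ _ u _ _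
    (is_derive_product _ _ u _ _ (D _ _ Hx Ha) (D _ _ Hy Hb))
    (is_derive_product _ _ u _ _ (D _ _ Hy Ha) (D _ _ Hx Hb))).
  apply is_derive_unique in E.
  rewrite (Derive_ext _ (fun _ => 0)) in E; [|intros z; exact (branch_parallel z)].
  rewrite Derive_const in E. unfold minus, plus, opp in E. simpl in E.
  destruct (tangent_ratio_spec u) as [Ex Ey]. unfold curvature_det.
  rewrite Ex, Ey in *. set (l := tangent_ratio u) in *.
  apply (f_equal (fun z => l * z)) in E. lra.
Qed.

Lemma inflexion_of_zero_curvature s : curvature_det f s = 0 -> inflexion f s.
Proof.
  intros H. apply NNPP. intros Hn. apply (generic_undulation f Hgen s).
  split; [now apply curvature_zero | exact Hn].
Qed.

(** The curvature has no other zeros near the inflexion a(u), so a pair of parallel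
    tangents near it has its two points on opposite sides of it; hence a' and b' cannot
    have the same sign, while h = a' - b' because f'(a) = f'(b). *)
Lemma caustic_speed_diagonal u0 : circle_pt (a u0) = circle_pt (b u0) -> caustic_speed u0 <> 0.
Proof.
  intros Hab Hz.
  assert (H0 := diagonal_zero_curvature f Hreg _ _ (HSigma u0) Hab).
  destruct (inflexion_of_zero_curvature _ H0) as (d & Hd & Hsign).
  assert (Hiso : forall x, a u0 - d < x < a u0 + d -> x <> a u0 -> curvature_det f x <> 0).
  { intros x Hxd Hne E. apply (curvature_zero f Hreg) in E.
    destruct (Rdichotomy _ _ Hne).
    - assert (K := Hsign x (a u0 + d / 2) ltac:(lra) ltac:(lra)). rewrite E in K. lra.
    - assert (K := Hsign (a u0 - d / 2) x ltac:(lra) ltac:(lra)). rewrite E in K. lra. }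
  destruct (circle_pt_eq _ _ Hab) as [k Hk].
  (* The lift of the second point that agrees with a at u0. *)
  set (b1 := fun u => b u + 2 * IZR k * PI).
  assert (Hb1 : smooth_on everywhere b1) by (unfold b1; auto with smooth).
  assert (Eb1 : forall u, Derive b1 u = Derive b u).
  { intros u. apply is_derive_unique. unfold b1.
    replace (Derive b u) with (plus (Derive b u) zero) by (unfold plus, zero; simpl; ring).
    apply (is_derive_plus (V := R_NormedModule) b (fun _ => 2 * IZR k * PI)).
    - apply Derive_correct. now apply smooth_on_ex_derive with everywhere.
    - apply (is_derive_const (V := R_NormedModule)). }
  assert (Hpar : forall u, tangent_det f (a u) (b1 u) = 0).
  { intros u. rewrite <- (branch_parallel u). unfold tangent_det, b1.
    now destruct (deriv1_periodic f Hreg _ _ (circle_pt_shift (b u) k)) as [-> ->]. }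
  destruct (parallel_tangents_enclose_zero_curvature f Hreg (a u0)) as (r & Hr & Hroll).
  set (e := Rmin r d).
  assert (He : 0 < e) by now apply Rmin_glb_lt.
  assert (He1 : e <= r) by apply Rmin_l. assert (He2 : e <= d) by apply Rmin_r.
  assert (Hnear : locally u0 (fun u => (a u0 - e < a u < a u0 + e) /\ (a u0 - e < b1 u < a u0 + e))).
  { apply filter_and.
    - apply (smooth_on_continuous everywhere a u0 Ha I (fun x => a u0 - e < x < a u0 + e)).
      apply (open_between (a u0 - e) (a u0 + e)). lra.
    - apply (smooth_on_continuous everywhere b1 u0 Hb1 I (fun x => a u0 - e < x < a u0 + e)).
      apply (open_between (a u0 - e) (a u0 + e)). unfold b1. lra. }
  assert (Hsep : forall u, a u0 - e < a u < a u0 + e -> a u0 - e < b1 u < a u0 + e ->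
    (a u - a u0) * (b1 u - a u0) <= 0).
  { intros u H1 H2. apply Rnot_lt_le. intros Hpos.
    assert (Hna : a u <> a u0) by (intros E; rewrite E in Hpos; lra).
    destruct (Rtotal_order (a u) (b1 u)) as [Hlt|[Heq|Hgt]].
    - destruct (Hroll (a u) (b1 u)) as (xi & Hxi & E); auto; try lra.
      apply (Hiso xi); [lra | | exact E]. intros Exi. nra.
    - apply (Hiso (a u)); [lra | exact Hna|].
      apply (diagonal_zero_curvature f Hreg _ _ (HSigma u)).
      rewrite Heq. apply circle_pt_shift.
    - destruct (Hroll (b1 u) (a u)) as (xi & Hxi & E); auto; try lra.
      { rewrite <- Ropp_0, <- (Hpar u). unfold tangent_det. ring. }
      apply (Hiso xi); [lra | | exact E]. intros Exi. nra. }
  assert (Hl : tangent_ratio u0 = 1).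
  { unfold tangent_ratio. destruct (deriv1_periodic f Hreg _ _ Hab) as [-> ->].
    assert (P := speed2_pos f Hreg (b u0)). unfold speed2 in *. field. lra. }
  unfold caustic_speed in Hz. rewrite Hl in Hz.
  assert (Hnz : Derive a u0 <> 0) by (intros E; apply (Himm u0); lra).
  assert (Hnb : Derive b1 u0 <> 0) by (rewrite Eb1; lra).
  assert (Da : is_derive (fun u => a u - a u0) u0 (Derive a u0)).
  { replace (Derive a u0) with (minus (Derive a u0) zero)
      by (unfold minus, plus, opp, zero; simpl; ring).
    apply (is_derive_minus (V := R_NormedModule) a (fun _ => a u0)).
    - apply Derive_correct. now apply smooth_on_ex_derive with everywhere.
    - apply (is_derive_const (V := R_NormedModule)). }
  assert (Db : is_derive (fun u => b1 u - a u0) u0 (Derive b1 u0)).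
  { replace (Derive b1 u0) with (minus (Derive b1 u0) zero)
      by (unfold minus, plus, opp, zero; simpl; ring).
    apply (is_derive_minus (V := R_NormedModule) b1 (fun _ => a u0)).
    - apply Derive_correct. now apply smooth_on_ex_derive with everywhere.
    - apply (is_derive_const (V := R_NormedModule)). }
  destruct (simple_zero_sign _ _ _ Da ltac:(lra) Hnz) as (e1 & He3 & S1).
  destruct (simple_zero_sign _ _ _ Db ltac:(unfold b1; lra) Hnb) as (e2 & He4 & S2).
  apply locally_R in Hnear. destruct Hnear as (e3 & He5 & S3).
  set (m := Rmin e1 (Rmin e2 e3)).
  assert (Hm : 0 < m /\ m <= e1 /\ m <= e2 /\ m <= e3).
  { unfold m, Rmin. repeat destruct (Rle_dec _ _); repeat split; lra. }
  set (u := u0 + m / 2).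
  assert (K1 := S1 u ltac:(unfold u; lra) ltac:(unfold u; lra)).
  assert (K2 := S2 u ltac:(unfold u; lra) ltac:(unfold u; lra)). cbv beta in K1, K2.
  destruct (S3 u ltac:(unfold u; lra)) as [N1 N2].
  assert (K3 := Hsep u N1 N2). rewrite Eb1 in K2.
  replace (Derive b u0) with (Derive a u0) in K2 by lra.
  assert (K4 := Rmult_lt_0_compat _ _ K1 K2).
  replace ((a u - a u0) * Derive a u0 * (u - u0) * ((b1 u - a u0) * Derive a u0 * (u - u0)))
    with ((a u - a u0) * (b1 u - a u0) * (Derive a u0 * (u - u0)) ^ 2) in K4 by ring.
  assert (0 <= (Derive a u0 * (u - u0)) ^ 2) by apply pow2_ge_0. nra.
Qed.

(** At a singular point D(a) = lambda^3 D(b) for the numerators D of the curvature, so an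
    inflexion at one of the two points would force one at the other, against genericity. *)
Lemma singular_point_nondegenerate u0 : circle_pt (a u0) <> circle_pt (b u0) ->
  caustic_speed u0 = 0 ->
  parallel_pair f (a u0) (b u0) /\ Derive a u0 <> 0 /\ Derive b u0 <> 0 /\
  curvature_det f (b u0) <> 0.
Proof.
  intros Hab Hz. unfold caustic_speed in Hz.
  assert (Hpp : parallel_pair f (a u0) (b u0)).
  { split; [|exact (branch_parallel u0)]. intros E.
    exact (generic_crossing f Hgen _ _ Hab E (branch_parallel u0)). }
  assert (Hl := tangent_ratio_nonzero u0).
  assert (Hna : Derive a u0 <> 0).
  { intros E. apply (Himm u0 E). rewrite E in Hz. lra. }
  assert (Hnb : Derive b u0 <> 0).
  { replace (Derive b u0) with (Derive a u0 * tangent_ratio u0) by lra.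
    now apply Rmult_integral_contrapositive_currified. }
  assert (ED : curvature_det f (a u0) = tangent_ratio u0 ^ 3 * curvature_det f (b u0)).
  { apply Rmult_eq_reg_l with (Derive a u0); [|exact Hna]. rewrite equal_turning.
    replace (Derive b u0) with (Derive a u0 * tangent_ratio u0) by lra. ring. }
  repeat split; try assumption; try apply Hpp.
  intros E. rewrite E, Rmult_0_r in ED.
  destruct (generic_parallel_inflexion f Hgen _ _ Hpp) as [H|H]; apply H;
    now apply inflexion_of_zero_curvature.
Qed.

Lemma tangent_ratio_abs sg u : sg = 1 \/ sg = -1 -> 0 < sg * tangent_ratio u ->
  tangent_ratio u * speed f (b u) = sg * speed f (a u).
Proof.
  intros Hsg Hpos. assert (Va := speed_pos f Hreg (a u)). assert (Vb := speed_pos f Hreg (b u)).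
  assert (E := tangent_ratio_sqr u). rewrite <- !(speed_sqr f Hreg) in E.
  assert (Q : 0 < sg * tangent_ratio u * speed f (b u)) by now apply Rmult_lt_0_compat.
  assert (F : sg * tangent_ratio u * speed f (b u) = speed f (a u)) by (destruct Hsg; subst; nra).
  rewrite <- F. destruct Hsg; subst; ring.
Qed.

(** Equal turning says a' V(a) k(a) = b' V(b) k(b), for the speed V and the curvature k
    of f. With the sign sg of lambda, and b' = a' lambda - h, this becomes
    a' V(a) (k(a) - sg k(b)) = - h V(b) k(b). If h and h' vanish, then so does the
    derivative of k(a) - sg k(b), which means that the two curvatures have equal
    derivatives with respect to arc length. *)
Lemma caustic_speed_simple_zero u0 : circle_pt (a u0) <> circle_pt (b u0) ->
  caustic_speed u0 = 0 -> Derive caustic_speed u0 <> 0.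
Proof.
  intros Hab Hz Hdz.
  destruct (singular_point_nondegenerate u0 Hab Hz) as (Hpp & Hna & _ & _).
  assert (Hsg : exists sg, (sg = 1 \/ sg = -1) /\ 0 < sg * tangent_ratio u0).
  { destruct (Rdichotomy _ _ (tangent_ratio_nonzero u0)); [exists (-1) | exists 1]; split; auto; lra. }
  destruct Hsg as (sg & Hsg & Hpos).
  assert (Hsg2 : sg * sg = 1) by (destruct Hsg; subst; ring).
  set (k := curvature f). set (V := speed f).
  assert (Hk : smooth_on everywhere k) by exact (curvature_smooth f Hreg).
  assert (HV : smooth_on everywhere V) by exact (speed_smooth f Hreg).
  assert (VP : forall s, 0 < V s) by exact (speed_pos f Hreg).
  assert (Dk : forall s, curvature_det f s = k s * V s ^ 3).
  { intros s. unfold k. rewrite curvature_eq. fold V. specialize (VP s). field. lra. }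
  set (psi := fun u => k (a u) - sg * k (b u)).
  assert (Hpsi : smooth_on everywhere psi) by (unfold psi; auto with smooth).
  assert (Turn : forall u, Derive a u * V (a u) * k (a u) = Derive b u * V (b u) * k (b u)).
  { intros u. assert (E := equal_turning u). rewrite !Dk in E.
    assert (Q := tangent_ratio_sqr u). rewrite <- !(speed_sqr f Hreg) in Q. fold V in Q.
    assert (P := VP (a u)). assert (P' := VP (b u)).
    apply Rmult_eq_reg_l with (V (a u) ^ 2); [|apply pow_nonzero; lra].
    transitivity (Derive a u * (k (a u) * V (a u) ^ 3)); [ring|]. rewrite E, Q. ring. }
  set (P := fun u => Derive a u * V (a u)). set (Q := fun u => - (V (b u) * k (b u))).
  assert (HP : smooth_on everywhere P) by (unfold P; auto with smooth).
  assert (HQ : smooth_on everywhere Q) by (unfold Q; auto with smooth).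
  assert (Hloc : forall u, 0 < sg * tangent_ratio u -> P u * psi u = caustic_speed u * Q u).
  { intros u Hu. assert (R := tangent_ratio_abs sg u Hsg Hu). fold V in R.
    unfold P, psi, Q, caustic_speed.
    transitivity (Derive a u * V (a u) * k (a u) - Derive a u * (sg * V (a u)) * k (b u)); [ring|].
    rewrite Turn, <- R. ring. }
  assert (psi0 : psi u0 = 0).
  { assert (E := Hloc u0 Hpos). rewrite Hz, Rmult_0_l in E. apply Rmult_integral in E.
    destruct E as [E|E]; [|exact E]. exfalso. unfold P in E. specialize (VP (a u0)).
    apply Rmult_integral in E. lra. }
  assert (SD : forall g, smooth_on everywhere g -> is_derive g u0 (Derive g u0)).
  { intros g Hg. apply Derive_correct. now apply smooth_on_ex_derive with everywhere. }
  assert (E1 := is_derive_product _ _ _ _ _ (SD _ HP) (SD _ Hpsi)).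
  assert (E2 := is_derive_product _ _ _ _ _ (SD _ caustic_speed_smooth) (SD _ HQ)).
  assert (Dpsi : Derive psi u0 = 0).
  { assert (HL : locally u0 (fun u => P u * psi u = caustic_speed u * Q u)).
    { apply (filter_imp (fun u => 0 < sg * tangent_ratio u)); [exact Hloc|].
      apply (smooth_on_continuous everywhere (fun u => sg * tangent_ratio u) u0
        ltac:(auto using tangent_ratio_smooth with smooth) I (fun z => 0 < z)).
      now apply (open_gt 0). }
    apply (is_derive_ext_loc _ _ _ _ HL), is_derive_unique in E1.
    apply is_derive_unique in E2. assert (E3 := eq_trans (eq_sym E1) E2).
    rewrite psi0, Hz, Hdz in E3.
    assert (F : P u0 * Derive psi u0 = 0) by lra.
    apply Rmult_integral in F. destruct F as [F|F]; [|exact F]. exfalso. unfold P in F.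
    specialize (VP (a u0)). apply Rmult_integral in F. lra. }
  assert (Dpsi' : Derive psi u0 = Derive a u0 * Derive k (a u0) - sg * (Derive b u0 * Derive k (b u0))).
  { apply is_derive_unique.
    apply (is_derive_minus (V := R_NormedModule) (fun u => k (a u)) (fun u => sg * k (b u))).
    - now apply is_derive_smooth_comp.
    - apply (is_derive_scal (fun u => k (b u))). now apply is_derive_smooth_comp. }
  assert (Eb : Derive b u0 * V (b u0) = Derive a u0 * (sg * V (a u0))).
  { assert (R := tangent_ratio_abs sg u0 Hsg Hpos). fold V in R. rewrite <- R.
    unfold caustic_speed in Hz. replace (Derive b u0) with (Derive a u0 * tangent_ratio u0) by lra.
    ring. }
  destruct (arc_length_param_exists f (a u0) 1 Hreg ltac:(now left)) as (p1 & A1 & B1 & C1 & D1).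
  destruct (arc_length_param_exists f (b u0) sg Hreg Hsg) as (p2 & A2 & B2 & C2 & D2).
  assert (PVa := VP (a u0)). assert (PVb := VP (b u0)).
  apply (generic_parallel_curvature f Hgen _ _ Hab Hpp p1 p2 A1 A2).
  - exists 1. split; [lra|]. rewrite B1, B2. cbn [fst snd]. fold V.
    destruct (tangent_ratio_spec u0) as [-> ->].
    assert (R := tangent_ratio_abs sg u0 Hsg Hpos). fold V in R.
    assert (R' : tangent_ratio u0 = sg * V (a u0) / V (b u0)) by (rewrite <- R; field; lra).
    rewrite R'. apply (f_equal2 pair); field; lra.
  - rewrite C1, C2. fold k. unfold psi in psi0. lra.
  - rewrite D1, D2. fold k V.
    apply Rmult_eq_reg_l with (Derive a u0 * V (a u0)).
    + transitivity (Derive a u0 * Derive k (a u0)); [field; lra|].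
      transitivity (sg * (Derive b u0 * Derive k (b u0))); [lra|].
      replace (Derive b u0) with (Derive a u0 * (sg * V (a u0)) / V (b u0))
        by (rewrite <- Eb; field; lra).
      transitivity (sg * sg * (Derive a u0 * V (a u0) * (Derive k (b u0) / V (b u0))));
        [field; lra | rewrite Hsg2; ring].
    + apply Rmult_integral_contrapositive_currified; lra.
Qed.

(** If C' = h T with h = 0 and h' <> 0, then det (C'', C''') = 2 h'^2 det (T, T'); here
    T = f'(b), and det (T, T') = b' D(b) for the numerator D of the curvature. *)
Lemma cusp_iff_caustic_speed_zero (C : R -> plane) u0 :
  (forall u, C u = vsub (f (a u)) (f (b u))) -> cusp C u0 <-> caustic_speed u0 = 0.
Proof.
  intros HC. set (h := caustic_speed).
  assert (Hh : smooth_on everywhere h) by exact caustic_speed_smooth.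
  set (T1 := fun u => Derive (xc f) (b u)). set (T2 := fun u => Derive (yc f) (b u)).
  assert (HT1 : smooth_on everywhere T1) by (unfold T1; auto with smooth).
  assert (HT2 : smooth_on everywhere T2) by (unfold T2; auto with smooth).
  assert (Dcoord : forall g, smooth_on everywhere g ->
    (forall u, Derive g (a u) = tangent_ratio u * Derive g (b u)) -> forall u,
    is_derive (fun u => g (a u) - g (b u)) u (h u * Derive g (b u))).
  { intros g Hg E u.
    replace (h u * Derive g (b u)) with (Derive a u * Derive g (a u) - Derive b u * Derive g (b u))
      by (unfold h, caustic_speed; rewrite E; ring).
    apply (is_derive_minus (V := R_NormedModule) (fun u => g (a u)) (fun u => g (b u)));
      now apply is_derive_smooth_comp. }
  assert (DX : forall u, is_derive (fun u => fst (C u)) u (h u * T1 u)).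
  { intros u. apply is_derive_ext with (fun u => xc f (a u) - xc f (b u)).
    - intros z. now rewrite HC.
    - apply (Dcoord (xc f) Hx). intros z. apply tangent_ratio_spec. }
  assert (DY : forall u, is_derive (fun u => snd (C u)) u (h u * T2 u)).
  { intros u. apply is_derive_ext with (fun u => yc f (a u) - yc f (b u)).
    - intros z. now rewrite HC.
    - apply (Dcoord (yc f) Hy). intros z. apply tangent_ratio_spec. }
  assert (D1 : deriv 1 C u0 = (h u0 * T1 u0, h u0 * T2 u0)).
  { apply (f_equal2 pair); apply is_derive_unique; [apply DX | apply DY]. }
  split.
  - intros [H _]. rewrite D1 in H. injection H as H1 H2.
    apply NNPP. intros Hne. assert (P := speed2_pos f Hreg (b u0)).
    apply Rmult_integral in H1. apply Rmult_integral in H2.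
    destruct H1 as [H1|H1]; [contradiction|]. destruct H2 as [H2|H2]; [contradiction|].
    unfold speed2 in P. fold (T1 u0) (T2 u0) in P. rewrite H1, H2 in P. lra.
  - intros Hz. fold h in Hz.
    assert (Hab : circle_pt (a u0) <> circle_pt (b u0)).
    { intros E. exact (caustic_speed_diagonal u0 E Hz). }
    destruct (singular_point_nondegenerate u0 Hab Hz) as (_ & _ & Hnb & HDb).
    assert (Hdz := caustic_speed_simple_zero u0 Hab Hz). fold h in Hdz.
    apply cusp_of_independent_derivatives.
    + intros t. split.
      * apply (smooth_on_intro everywhere _ (fun u => h u * T1 u)); auto with smooth. exact I.
      * apply (smooth_on_intro everywhere _ (fun u => h u * T2 u)); auto with smooth. exact I.
    + rewrite D1, Hz. apply (f_equal2 pair); ring.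
    + assert (Higher : forall g T, smooth_on everywhere T -> (forall u, is_derive g u (h u * T u)) ->
        Derive_n g 2 u0 = Derive h u0 * T u0 /\
        Derive_n g 3 u0 = Derive (Derive h) u0 * T u0 + 2 * (Derive h u0 * Derive T u0)).
      { intros g T HT Dg.
        assert (SD : forall q u, smooth_on everywhere q -> is_derive q u (Derive q u)).
        { intros q u Hq. apply Derive_correct. now apply smooth_on_ex_derive with everywhere. }
        assert (G2 : forall u, Derive (Derive g) u = Derive h u * T u + h u * Derive T u).
        { intros u. rewrite (Derive_ext _ (fun u => h u * T u)).
          - apply is_derive_unique, is_derive_product; auto.
          - intros z. now apply is_derive_unique. }
        split.
        - change (Derive_n g 2 u0) with (Derive (Derive g) u0). rewrite G2, Hz. ring.
        - change (Derive_n g 3 u0) with (Derive (Derive (Derive g)) u0).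
          rewrite (Derive_ext _ _ _ G2).
          assert (E := is_derive_plus (V := R_NormedModule) _ _ u0 _ _
            (is_derive_product _ _ _ _ _ (SD (Derive h) u0 ltac:(auto with smooth)) (SD T u0 HT))
            (is_derive_product _ _ _ _ _ (SD h u0 Hh) (SD (Derive T) u0 ltac:(auto with smooth)))).
          apply is_derive_unique in E. unfold plus in E. simpl in E. etransitivity; [exact E|].
          rewrite Hz. ring. }
      destruct (Higher (fun u : R => fst (C u)) T1 HT1 DX) as [X2 X3].
      destruct (Higher (fun u : R => snd (C u)) T2 HT2 DY) as [Y2 Y3].
      change (Derive_n (fun u => fst (C u)) 2 u0 * Derive_n (fun u => snd (C u)) 3 u0
        - Derive_n (fun u => snd (C u)) 2 u0 * Derive_n (fun u => fst (C u)) 3 u0 <> 0).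
      rewrite X2, X3, Y2, Y3.
      assert (ET1 : Derive T1 u0 = Derive b u0 * Derive (Derive (xc f)) (b u0)).
      { apply is_derive_unique, (is_derive_smooth_comp (Derive (xc f))); auto with smooth. }
      assert (ET2 : Derive T2 u0 = Derive b u0 * Derive (Derive (yc f)) (b u0)).
      { apply is_derive_unique, (is_derive_smooth_comp (Derive (yc f))); auto with smooth. }
      replace (_ - _) with (2 * Derive h u0 ^ 2 * (Derive b u0 * curvature_det f (b u0))).
      * repeat apply Rmult_integral_contrapositive_currified; assumption || lra.
      * rewrite ET1, ET2. unfold curvature_det, T1, T2. ring.
Qed.

End Branch.

(** An angle lifting a periodic motion on the circle need not be periodic, but its
    derivative is. *)
Lemma Derive_circle_lift (a : R -> R) T : smooth_on everywhere a ->
  (forall u, circle_pt (a (u + T)) = circle_pt (a u)) ->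
  forall u, Derive a (u + T) = Derive a u.
Proof.
  intros Ha HT u.
  assert (HaT : smooth_on everywhere (fun u => a (u + T))).
  { apply smooth_on_comp_everywhere; auto with smooth. }
  assert (Hs : forall k, smooth_on everywhere k ->
    is_derive (fun u => sin (k u)) u (Derive k u * cos (k u)) /\
    is_derive (fun u => cos (k u)) u (Derive k u * - sin (k u))).
  { intros k Hk. assert (Dk : is_derive k u (Derive k u))
      by (apply Derive_correct; now apply smooth_on_ex_derive with everywhere).
    split; apply is_derive_compose; try exact Dk; [apply is_derive_sin | apply is_derive_cos]. }
  destruct (Hs _ Ha) as [S1 C1]. destruct (Hs _ HaT) as [S2 C2]. rewrite Derive_shift in S2, C2.
  assert (Ec : forall z, cos (a (z + T)) = cos (a z)) by (intros z; exact (f_equal fst (HT z))).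
  assert (Es : forall z, sin (a (z + T)) = sin (a z)) by (intros z; exact (f_equal snd (HT z))).
  apply (is_derive_ext _ _ _ _ Es) in S2. apply (is_derive_ext _ _ _ _ Ec) in C2.
  apply is_derive_unique in S1, S2, C1, C2.
  assert (F1 := eq_trans (eq_sym S1) S2). assert (F2 := eq_trans (eq_sym C1) C2).
  rewrite Ec in F1. rewrite Es in F2.
  assert (Q := sin2_cos2 (a u)). unfold Rsqr in Q.
  set (c := cos (a u)) in *. set (s := sin (a u)) in *.
  transitivity (Derive a (u + T) * (s * s + c * c)); [rewrite Q; ring|].
  transitivity ((Derive a (u + T) * c) * c - (Derive a (u + T) * - s) * s); [ring|].
  rewrite <- F1, <- F2. transitivity (Derive a u * (s * s + c * c)); [ring | rewrite Q; ring].
Qed.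

Theorem theorem3p20 (f C : R -> plane) (hf : generic f)
  (hC : smooth_branch f C) :
  exists cusps : list R,
    NoDup cusps /\
    (forall t : R, In t cusps <-> (0 <= t < 2 * PI /\ cusp C t)) /\
    Nat.Even (length cusps).
Proof.
  destruct hC as (K & gam & HK & (Hsm & Hper & Himm & _ & Hpar) & HC).
  set (a := fun u => fst (gam u)). set (b := fun u => snd (gam u)).
  assert (Ha : smooth_on everywhere a) by (intros t _; apply Hsm).
  assert (Hb : smooth_on everywhere b) by (intros t _; apply Hsm).
  assert (Hi : forall u, Derive a u = 0 -> Derive b u = 0 -> False).
  { intros u E1 E2. apply (Himm u). apply (f_equal2 pair); assumption. }
  assert (Hsig : forall u, Sigma f (torus_pt (a u, b u))).
  { intros u. destruct HK as (x & _ & HK).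
    assert (Ku : K (torus_pt (a u, b u))) by (apply Hpar; exists u; reflexivity).
    apply HK in Ku. destruct Ku as (B & _ & HB & _ & Hu). now apply HB. }
  set (h := caustic_speed f a b).
  assert (Hh : smooth_on everywhere h) by exact (caustic_speed_smooth f a b hf Ha Hb).
  assert (Pa : forall u, circle_pt (a (u + 2 * PI)) = circle_pt (a u))
    by (intros u; exact (f_equal fst (Hper u))).
  assert (Pb : forall u, circle_pt (b (u + 2 * PI)) = circle_pt (b u))
    by (intros u; exact (f_equal snd (Hper u))).
  assert (Ph : forall u, h (u + 2 * PI) = h u).
  { intros u. unfold h, caustic_speed, tangent_ratio, speed2.
    rewrite (Derive_circle_lift a _ Ha Pa), (Derive_circle_lift b _ Hb Pb).
    destruct (deriv1_periodic f (generic_regular f hf) _ _ (Pa u)) as [-> ->].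
    destruct (deriv1_periodic f (generic_regular f hf) _ _ (Pb u)) as [-> ->]. reflexivity. }
  assert (HPI := PI_RGT_0).
  destruct (even_number_of_simple_zeros h (Derive h) 0 (2 * PI)) as (l & N & I & E).
  - lra.
  - intros t. apply Derive_correct. now apply smooth_on_ex_derive with everywhere.
  - intros t Ht. apply (caustic_speed_simple_zero f a b hf Ha Hb Hi Hsig); [|exact Ht].
    intros Hab. exact (caustic_speed_diagonal f a b hf Ha Hb Hi Hsig t Hab Ht).
  - rewrite <- (Ph 0). now rewrite Rplus_0_l.
  - rewrite <- (Derive_periodic h Ph 0). now rewrite Rplus_0_l.
  - exists l. split; [exact N|]. split; [|exact E].
    intros t. rewrite I. now rewrite (cusp_iff_caustic_speed_zero f a b hf Ha Hb Hi Hsig C t HC).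
Qed.
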